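(* Let $H=Pa\cup_{e_{rep}}Cy$ be a cycle-with-handles, where $Pa$ is an $st$-path, $e_{rep}\in E(Pa)$, and $Cy$ is an $st$-cycle consisting of two directed paths $\gamma_1,\gamma_2$ from $s_{Cy}$ to $t_{Cy}$ with $\gamma_1\cap\gamma_2=\{s_{Cy},t_{Cy}\}$. Let $d_{rep}=d_{Pa}(e_{rep})$ and $ht_{cyc}=\max_{u_1\in\gamma_1}\mathrm{dist}_{Cy}(u_1,\{s_{Cy},t_{Cy}\})+\max_{u_2\in\gamma_2}\mathrm{dist}_{Cy}(u_2,\{s_{Cy},t_{Cy}\})$. Then $$c_1(\mathrm{TC}(H^{\oslash n}))\ge\frac{2-\sqrt2}{4}\,d_{rep}\,ht_{cyc}\cdot n\quad\text{for every }n\ge0.$$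
   Context: An $st$-graph is a finite directed graph $G$ with directed edge set $E(G)$, distinct vertices $s_G,t_G$, positive edge lengths $d_G(e)$, with $d_G$ also denoting the induced shortest-path metric on $V(G)$ (each edge's length equals the distance between its endpoints), and a thickness $th_G:E(G)\to(0,1]$, such that $d_G(s_G,t_G)=1$, every directed path is a geodesic, and there is a finite family $\{\gamma_i\}_{i\in I}$ of directed edge paths from $s_G$ to $t_G$ with $th_G(e)=|\{i:e\in\gamma_i\}|/|I|$. An $st$-path is an $st$-graph that is a single directed path from $s$ to $t$ with all thicknesses $1$; the trivial $st$-path has one edge $(s,t)$ of length 1. An $st$-cycle is an $st$-graph that is the union of two directed paths from $s$ to $t$, each with at least three vertices, sharing only $s,t$, with all thicknesses $\tfrac12$. Edge replacement: for $st$-graphs $G,K$ and $e=(u,v)\in E(G)$, $G\cup_eK$ is obtained from the disjoint union by identifying $u$ with $s_K$, $v$ with $t_K$ and deleting $e$; copied edges $e'$ of $K$ get length $d_G(e)d_K(e')$ and thickness $th_G(e)th_K(e')$, other edges keep their data, the metric is the resulting shortest-path metric, and source/sink are $s_G,t_G$. The slash product $G\oslash K$ replaces every edge of $G$ in this way. $H^{\oslash0}$ is the trivial $st$-path and $H^{\oslash(n+1)}=H^{\oslash n}\oslash H$. $\mathrm{TC}(X)$ for a finite metric space is the space of zero-total-mass signed measures with norm $\inf\sum a_id(x_i,y_i)$ over representations $\sum a_i(\delta_{x_i}-\delta_{y_i})$, $a_i\ge0$; $c_1(Y)$ is the infimal bi-Lipschitz distortion of embeddings of $Y$ into $L_1$-spaces.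 *)

(* Defs.v *)
From HB Require Import structures.
From mathcomp Require Import all_boot all_order all_algebra.
From mathcomp Require Import all_classical all_reals all_analysis.

Set Implicit Arguments.
Unset Strict Implicit.
Unset Printing Implicit Defensive.

Import Order.TTheory GRing.Theory Num.Theory.
Local Open Scope classical_set_scope.
Local Open Scope ring_scope.

Record stgraph (R : realType) := STGraph {
  vert : finType;
  edge : finType;
  src : edge -> vert;
  tgt : edge -> vert;
  sv : vert;
  tv : vert;
  len : edge -> R;
  th : edge -> R
}.
Arguments src {R s} : rename.
Arguments tgt {R s} : rename.
Arguments sv {R} s.
Arguments tv {R} s.
Arguments len {R s} : rename.
Arguments th {R s} : rename.

Section Defs.
Variable R : realType.

Fixpoint uwalk (G : stgraph R) (u : vert G) (w : seq (edge G * bool))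
    (v : vert G) : bool :=
  match w with
  | [::] => u == v
  | (e, b) :: w' =>
      if b then (src e == u) && uwalk (tgt e) w' v
      else (tgt e == u) && uwalk (src e) w' v
  end.

Definition dist (G : stgraph R) (u v : vert G) : R :=
  inf [set r : R | exists w, uwalk u w v /\ r = \sum_(p <- w) len p.1].

Fixpoint dwalk (G : stgraph R) (u : vert G) (es : seq (edge G)) : bool :=
  match es with
  | [::] => true
  | e :: es' => (src e == u) && dwalk (tgt e) es'
  end.

Definition dpath (G : stgraph R) (u : vert G) (es : seq (edge G)) : bool :=
  dwalk u es && uniq (u :: map tgt es).

Definition dpath_end (G : stgraph R) (u : vert G) (es : seq (edge G)) :=
  last u (map tgt es).

Definition is_stgraph (G : stgraph R) : Prop :=
  [/\ sv G != tv G,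
      (forall e : edge G, 0 < len e),
      (forall e : edge G, len e = dist (src e) (tgt e)) /\
      dist (sv G) (tv G) = 1,
      (forall (u : vert G) es, dpath u es ->
          \sum_(e <- es) len e = dist u (dpath_end u es)) &
      exists F : seq (seq (edge G)),
        [/\ (0 < size F)%N,
            (forall g, g \in F -> dpath (sv G) g /\ dpath_end (sv G) g = tv G) &
            (forall e : edge G, 0 < th e <= 1) /\
            forall e, th e = (count (fun g => e \in g) F)%:R / (size F)%:R]].

Definition consec (T : Type) (g : seq T) := zip g (behead g).

Definition edges_are (G : stgraph R) (P : seq (vert G * vert G)) : Prop :=
  (forall e : edge G, (src e, tgt e) \in P) /\
  (forall p, p \in P -> #|[pred e : edge G | (src e, tgt e) == p]| = 1%N).

Definition is_stpath (G : stgraph R) : Prop :=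
  [/\ is_stgraph G,
      (forall e : edge G, th e = 1) &
      exists g' : seq (vert G),
        let g := sv G :: g' in
        [/\ uniq g, last (sv G) g' = tv G, (forall v, v \in g) &
            edges_are (consec g)]].

Definition is_stcycle (G : stgraph R) (g1 g2 : seq (vert G)) : Prop :=
  [/\ is_stgraph G,
      (forall e : edge G, th e = 2^-1),
      [/\ head (tv G) g1 = sv G, last (sv G) g1 = tv G, (3 <= size g1)%N
        & uniq g1] /\
      [/\ head (tv G) g2 = sv G, last (sv G) g2 = tv G, (3 <= size g2)%N
        & uniq g2],
      (forall v, v \in g1 -> v \in g2 -> v = sv G \/ v = tv G) /\
      (forall v, v \in g1 \/ v \in g2) &
      edges_are (consec g1 ++ consec g2)].

Definition inner (K : stgraph R) :=
  {v : vert K | (v != sv K) && (v != tv K)}.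

(* vertex of K, seen in G u_e K *)
Definition emb_rep (G K : stgraph R) (e : edge G) (v : vert K)
    : (vert G + inner K)%type :=
  match (insub v : option (inner K)) with
  | Some w => inr w
  | None => if v == sv K then inl (src e) else inl (tgt e)
  end.

Definition edge_replace (G : stgraph R) (e : edge G) (K : stgraph R)
    : stgraph R :=
  @STGraph R
    (vert G + inner K)%type
    ({e' : edge G | e' != e} + edge K)%type
    (fun f => match f with inl e' => inl (src (val e'))
                          | inr k => emb_rep e (src k) end)
    (fun f => match f with inl e' => inl (tgt (val e'))
                          | inr k => emb_rep e (tgt k) end)
    (inl (sv G)) (inl (tv G))
    (fun f => match f with inl e' => len (val e')
                          | inr k => len e * len k end)
    (fun f => match f with inl e' => th (val e')
                          | inr k => th e * th k end).

(* vertex of the copy of K replacing edge e in G (/) K *)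
Definition emb_sl (G K : stgraph R) (e : edge G) (v : vert K)
    : (vert G + (edge G * inner K))%type :=
  match (insub v : option (inner K)) with
  | Some w => inr (e, w)
  | None => if v == sv K then inl (src e) else inl (tgt e)
  end.

Definition slash (G K : stgraph R) : stgraph R :=
  @STGraph R
    (vert G + (edge G * inner K))%type
    (edge G * edge K)%type
    (fun f => emb_sl f.1 (src f.2))
    (fun f => emb_sl f.1 (tgt f.2))
    (inl (sv G)) (inl (tv G))
    (fun f => len f.1 * len f.2)
    (fun f => th f.1 * th f.2).

Definition trivial_stpath : stgraph R :=
  @STGraph R bool unit (fun _ => false) (fun _ => true) false true
    (fun _ => 1) (fun _ => 1).

Fixpoint spow (H : stgraph R) (n : nat) : stgraph R :=
  match n with
  | 0 => trivial_stpath
  | n'.+1 => slash (spow H n') H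
  end.

Definition TC (G : stgraph R) := {mu : vert G -> R | \sum_v mu v = 0}.

Definition tc_norm (G : stgraph R) (mu : vert G -> R) : R :=
  inf [set r : R | exists l : seq (R * vert G * vert G),
        [/\ all (fun q => 0 <= q.1.1) l,
            (forall x, mu x =
               \sum_(q <- l) q.1.1 * ((q.1.2 == x)%:R - (q.2 == x)%:R)) &
            r = \sum_(q <- l) q.1.1 * dist q.1.2 q.2]].

Definition tc_dist (G : stgraph R) (x y : TC G) : R :=
  tc_norm (fun v => sval x v - sval y v).

Definition L1_embeds (X : Type) (dX : X -> X -> R) (D : R) : Prop :=
  exists (d : measure_display) (T : measurableType d)
         (mu : {measure set T -> \bar R}) (f : X -> T -> R) (r : R),
    [/\ 0 < r,
        (forall x, mu.-integrable setT (EFin \o f x)) &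
        forall x y,
          ((r * dX x y)%:E <= \int[mu]_t (`|f x t - f y t|)%:E)%E /\
          (\int[mu]_t (`|f x t - f y t|)%:E <= (D * r * dX x y)%:E)%E].

(* c_1(X): infimal distortion, +oo if there is no such embedding *)
Definition c1 (X : Type) (dX : X -> X -> R) : \bar R :=
  ereal_inf [set D%:E | D in L1_embeds dX].

Definition dist_st (G : stgraph R) (u : vert G) : R :=
  Num.min (dist u (sv G)) (dist u (tv G)).

Definition ht_cyc (G : stgraph R) (g1 g2 : seq (vert G)) : R :=
  \big[Num.max/0]_(u <- g1) dist_st u + \big[Num.max/0]_(u <- g2) dist_st u.

End Defs.

Arguments is_stcycle {R} G g1 g2.
Arguments ht_cyc {R} G g1 g2.
Arguments edge_replace {R} G e K.
Arguments dist {R} G u v.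

(* Main.v *)
Require Import Defs.
From HB Require Import structures.
From mathcomp Require Import all_boot all_order all_algebra.
From mathcomp Require Import all_classical all_reals all_analysis.
From mathcomp Require Import ring lra zify.
Import Order.TTheory GRing.Theory Num.Theory.
Local Open Scope ring_scope.

Set Implicit Arguments.
Unset Strict Implicit.
Unset Printing Implicit Defensive.

(** An edge [e] of [H^k] has thickness [2^-i] for some [i]; attach to it the
    molecule [d_{u_e} - d_{w_e}] on the highest vertices of the two sides of
    its cycle. Collect the molecules by [i], not by the stage [k]: those of the
    same [i] live on disjoint cycles, so a signed sum of them, weighted by
    [2^-i], has transportation cost equal to the sum of the costs, and over all
    [i] these costs add up to [len e_rep * ht_cyc * n].

    Conversely, for [f : V -> R], the expectation over random signs of the
    pairing of [f] with these sums is at most [(1 - sqrt 2 / 2)^-1] times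
    [\sum_e th e |df e|]. By the layer-cake formula [f] may be taken to be the
    indicator of a set [S]; the edges cut by [S] then form a binary forest in
    which each generation halves the thickness, and the square function of the
    [2^i] nodes of thickness [2^-i] under one root decays like [2^(-i/2)].

    A map into [L_1] is reduced to linear functionals by averaging it over a
    large box: the average is almost additive at bounded scale, and at a still
    larger scale it has the same lower Lipschitz bound as the map. This yields
    the bound with [(2 - sqrt 2) / 2] in place of [(2 - sqrt 2) / 4]. *)

(** * Averaging boxes and limits *)

Lemma sum_cst_seq (R : realType) (I : Type) (s : seq I) (c : R) :
  \sum_(i <- s) c = (size s)%:R * c.
Proof. by rewrite big_const_seq count_predT iter_addr_0 mulr_natl. Qed.

(** [Y] is the box of all sums of multiples [a *+ i], [i < k], one for each generator, counted with
    multiplicity. Leaving out the direction [a] gives [Z], so [Y] splits into progressions of step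
    [a] and length [k]. *)
Lemma box_sum_decomposition (R : realType) (A : zmodType) (gens : seq A)
    (k : nat) : (0 < k)%N ->
  exists Y : seq A, (0 < size Y)%N /\
    forall a, a \in gens -> exists Z : seq A,
      size Y = (k * size Z)%N /\
      forall h : A -> R,
        \sum_(y <- Y) h y = \sum_(z <- Z) \sum_(i < k) h (z + a *+ i).
Proof.
move=> k0; elim: gens => [|a gens [Y [Y0 IH]]]; first by exists [:: 0].
have sumE (B : seq A) h : \sum_(y <- [seq b + a *+ i | b <- B, i <- iota 0 k]) h y
    = \sum_(b <- B) \sum_(i < k) h (b + a *+ i) :> R.
  rewrite big_allpairs_dep; apply: eq_bigr => b _.
  by rewrite -(big_mkord xpredT (fun i => h (b + a *+ i))) /index_iota subn0.
exists [seq y + a *+ i | y <- Y, i <- iota 0 k].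
split; first by rewrite size_allpairs size_iota muln_gt0 Y0.
move=> b; rewrite inE => /orP[/eqP ->|/IH [Z [sZ hZ]]].
  by exists Y; split; [rewrite size_allpairs size_iota mulnC | exact: sumE].
exists [seq z + a *+ i | z <- Z, i <- iota 0 k]; split.
  by rewrite !size_allpairs size_iota sZ mulnA.
move=> h; rewrite sumE hZ sumE; apply: eq_bigr => z _.
rewrite exchange_big; apply: eq_bigr => i _; apply: eq_bigr => j _.
by rewrite addrAC.
Qed.

Lemma le_of_le_add_inv (R : realType) (a b c : R) :
  (forall k : nat, a <= b + c / k.+1%:R) -> a <= b.
Proof.
move=> H; rewrite leNgt; apply/negP => ba.
have c0 : 0 < `|c| + 1 by rewrite ltr_pwDr.
pose k := Num.truncn ((`|c| + 1) / (a - b)).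
have d0 : 0 < a - b by rewrite subr_gt0.
have kP : (`|c| + 1) / (a - b) < k.+1%:R by exact: truncnS_gt.
have := H k; rewrite -lerBlDl ler_pdivlMr ?ltr0n//.
rewrite ltr_pdivrMr// mulrC in kP.
move=> /(lt_le_trans kP); have := ler_norm c; lra.
Qed.

(** * The seminorm of [L_1] *)

Section L1_seminorm.
Context {R : realType} {d : measure_display} {T : measurableType d}.
Variable mu : {measure set T -> \bar R}.

Definition L1norm (h : T -> R) : R := Rintegral mu setT (fun t => `|h t|).

Definition L1fun (h : T -> R) : Prop := mu.-integrable setT (EFin \o h).

Lemma L1funD f g : L1fun f -> L1fun g -> L1fun (fun t => f t + g t).
Proof.
move=> If Ig; have := integrableD measurableT If Ig.
by apply: eq_integrable => // t _; rewrite /= EFinD.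
Qed.

Lemma L1funZ c f : L1fun f -> L1fun (fun t => c * f t).
Proof.
move=> If; have := integrableZl measurableT c If.
by apply: eq_integrable => // t _; rewrite /= EFinM.
Qed.

Lemma L1funB f g : L1fun f -> L1fun g -> L1fun (fun t => f t - g t).
Proof.
move=> If /(L1funZ (-1)) Ig; rewrite (_ : (fun t => _) = (fun t => f t + -1 * g t)).
  exact: L1funD.
by apply/funext => t; rewrite mulN1r.
Qed.

Lemma L1fun_sum (I : Type) (s : seq I) (h : I -> T -> R) :
  (forall i, L1fun (h i)) -> L1fun (fun t => \sum_(i <- s) h i t).
Proof.
move=> Ih; elim: s => [|i s IH].
  rewrite (_ : (fun t => _) = (fun _ => 0)); first exact: integrable0.
  by apply/funext => t; rewrite big_nil.
rewrite (_ : (fun t => _) = (fun t => h i t + \sum_(i <- s) h i t)).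
  exact: L1funD.
by apply/funext => t; rewrite big_cons.
Qed.

Lemma L1fun_norm f : L1fun f -> L1fun (fun t => `|f t|).
Proof. exact: integrable_norm. Qed.

Lemma L1norm_sumE (I : Type) (s : seq I) (c : I -> R) (h : I -> T -> R) :
  (forall i, L1fun (h i)) ->
  Rintegral mu setT (fun t => \sum_(i <- s) c i * `|h i t|) =
  \sum_(i <- s) c i * L1norm (h i).
Proof.
move=> Ih; elim: s => [|i s IH].
  under eq_Rintegral do rewrite big_nil.
  by rewrite big_nil /Rintegral integral0.
under eq_Rintegral do rewrite big_cons.
rewrite big_cons RintegralD//; last 2 first.
- by apply: L1funZ; exact: L1fun_norm.
- by apply: L1fun_sum => j; apply: L1funZ; exact: L1fun_norm.
by rewrite IH RintegralZl//; exact: L1fun_norm.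
Qed.

(** Integrating a pointwise inequality is how scalar inequalities pass to $L_1$; the triangle
    inequalities below are instances. *)
Lemma L1norm_le_sum (I J : Type) (s : seq I) (c : I -> R) (h : I -> T -> R)
    (s' : seq J) (c' : J -> R) (h' : J -> T -> R) :
  (forall i, L1fun (h i)) -> (forall j, L1fun (h' j)) ->
  (forall t, \sum_(i <- s) c i * `|h i t| <= \sum_(j <- s') c' j * `|h' j t|) ->
  \sum_(i <- s) c i * L1norm (h i) <= \sum_(j <- s') c' j * L1norm (h' j).
Proof.
move=> Ih Ih' le_hh'; rewrite -!L1norm_sumE//; apply: le_Rintegral => //.
- by apply: L1fun_sum => j; apply: L1funZ; exact: L1fun_norm.
- by apply: L1fun_sum => j; apply: L1funZ; exact: L1fun_norm.
Qed.

Lemma L1norm_triangle f g h : L1fun f -> L1fun g -> L1fun h ->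
  (forall t, h t = f t + g t) -> L1norm h <= L1norm f + L1norm g.
Proof.
move=> If Ig Ih hE.
have := @L1norm_le_sum unit bool [:: tt] (fun=> 1) (fun=> h)
  [:: true; false] (fun=> 1) (fun b => if b then f else g).
rewrite !big_cons !big_nil !mul1r !addr0; apply => //; first by case.
by move=> t; rewrite !big_cons !big_nil !mul1r !addr0 hE ler_normD.
Qed.

Lemma eq_L1norm f g : (forall t, `|f t| = `|g t|) -> L1norm f = L1norm g.
Proof. by move=> fg; apply: eq_Rintegral => t _; rewrite fg. Qed.

Lemma L1norm_sum (I : Type) (s : seq I) (c : I -> R) (h : I -> T -> R) g :
  (forall i, L1fun (h i)) -> L1fun g -> (forall i, 0 <= c i) ->
  (forall t, g t = \sum_(i <- s) c i * h i t) ->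
  L1norm g <= \sum_(i <- s) c i * L1norm (h i).
Proof.
move=> Ih Ig c0 gE; have := @L1norm_le_sum unit I [:: tt] (fun=> 1) (fun=> g) s c h.
rewrite big_seq1 mul1r; apply => // t; rewrite big_seq1 mul1r gE.
rewrite (le_trans (ler_norm_sum _ _ _))//; apply: ler_sum => i _.
by rewrite normrM ger0_norm.
Qed.

End L1_seminorm.

(** * From nonlinear maps into [L_1] to linear functionals *)

Section Linearization.
Context {R : realType} {d : measure_display} {T : measurableType d}.
Variable mu : {measure set T -> \bar R}.
Context {A : zmodType} {V : Type}.
Variables (delta : V -> A) (F : A -> T -> R) (up : A -> R).
Hypothesis F_L1 : forall x, L1fun mu (F x).
Hypothesis F_up : forall x a, L1norm mu (fun t => F (x + a) t - F x t) <= up a.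

Let N := L1norm mu.

Definition pair_mass (l : seq (V * V)) : A :=
  \sum_(p <- l) (delta p.1 - delta p.2).

Definition box_avg (Y : seq A) (x : A) (t : T) : R :=
  \sum_(y <- Y) (size Y)%:R^-1 * F (x + y) t.

Lemma box_avg_L1 Y x : L1fun mu (box_avg Y x).
Proof. by apply: L1fun_sum => y; apply: L1funZ. Qed.

Lemma box_avg_up Y x a : (0 < size Y)%N ->
  N (fun t => box_avg Y (x + a) t - box_avg Y x t) <= up a.
Proof.
move=> Y0; apply: (@le_trans _ _ (\sum_(y <- Y) (size Y)%:R^-1 * up a)).
  apply: (@le_trans _ _ (\sum_(y <- Y) (size Y)%:R^-1 *
    N (fun t => F (x + y + a) t - F (x + y) t))).
    apply: L1norm_sum.
    - by move=> y; apply: L1funB.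
    - by apply: L1funB; exact: box_avg_L1.
    - by move=> _; rewrite invr_ge0.
    - move=> t; rewrite -sumrB; apply: eq_bigr => y _.
      by rewrite mulrBr (addrAC x a y).
  by apply: ler_sum => y _; rewrite ler_wpM2l ?invr_ge0.
rewrite sum_cst_seq mulrA mulfV ?mul1r//.
by rewrite pnatr_eq0 -lt0n.
Qed.

(** The bound does not depend on [x], so over a long distance replacing [F] by its average costs a
    bounded amount. *)
Lemma box_avg_close Y x : (0 < size Y)%N ->
  N (fun t => box_avg Y x t - F x t) <= \sum_(y <- Y) (size Y)%:R^-1 * up y.
Proof.
move=> Y0; apply: (@le_trans _ _ (\sum_(y <- Y) (size Y)%:R^-1 *
    N (fun t => F (x + y) t - F x t))).
  apply: L1norm_sum.
  - by move=> y; apply: L1funB.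
  - by apply: L1funB => //; exact: box_avg_L1.
  - by move=> _; rewrite invr_ge0.
  - move=> t; under [RHS]eq_bigr do rewrite mulrBr.
    rewrite sumrB; congr (_ - _).
    rewrite sum_cst_seq mulrA mulfV ?mul1r//.
    by rewrite pnatr_eq0 -lt0n.
by apply: ler_sum => y _; rewrite ler_wpM2l ?invr_ge0.
Qed.

(** The second differences telescope along each progression of step [c]. Only the end terms of the
    [size Y / k] progressions survive, each of seminorm at most [2 * up a]. *)
Lemma box_avg_diff_shift (Y Z : seq A) (c : A) (k : nat) : (0 < size Y)%N ->
  size Y = (k * size Z)%N ->
  (forall h : A -> R,
     \sum_(y <- Y) h y = \sum_(z <- Z) \sum_(i < k) h (z + c *+ i)) ->
  forall x a,
  N (fun t => (box_avg Y (x + c + a) t - box_avg Y (x + c) t) -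
              (box_avg Y (x + a) t - box_avg Y x t)) <= 2 * up a / k%:R.
Proof.
move=> Y0 sY hZ x a.
pose D y t := F (x + y + a) t - F (x + y) t.
have DL y : L1fun mu (D y) by apply: L1funB.
have k0 : k%:R != 0 :> R.
  by rewrite pnatr_eq0; apply: contraTneq Y0 => k0; rewrite sY k0.
have Z0 : (size Z)%:R != 0 :> R.
  by rewrite pnatr_eq0; apply: contraTneq Y0 => Z0; rewrite sY Z0 muln0.
apply: (@le_trans _ _ (\sum_(z <- Z) (size Y)%:R^-1 *
    N (fun t => D (z + c *+ k) t - D z t))).
  apply: L1norm_sum.
  - by move=> z; apply: L1funB.
  - by do 2![apply: L1funB; try exact: box_avg_L1].
  - by move=> _; rewrite invr_ge0.
  - move=> t; rewrite -mulr_sumr /box_avg -!mulr_sumr -!mulrBr; congr (_ * _).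
    rewrite -!sumrB.
    rewrite [LHS](_ : _ = \sum_(y <- Y) (D (y + c) t - D y t)); last first.
      apply: eq_bigr => y _; rewrite /D.
      congr (F _ t - F _ t - (F _ t - F _ t)); rewrite ?addrA //.
      - by rewrite (ACl (1 * 4 * 2 * 3)%AC).
      - by rewrite addrAC.
      - by rewrite addrAC.
    rewrite hZ; apply: eq_bigr => z _.
    under eq_bigr do rewrite -[z + _ + c]addrA -mulrSr.
    rewrite -(big_mkord xpredT (fun i => D (z + c *+ i.+1) t - D (z + c *+ i) t)).
    by rewrite telescope_sumr// mulr0n addr0.
apply: (@le_trans _ _ (\sum_(z <- Z) (size Y)%:R^-1 * (2 * up a))).
  apply: ler_sum => z _; rewrite ler_wpM2l ?invr_ge0// mulr_natl mulr2n.
  rewrite (le_trans (L1norm_triangle (f := D (z + c *+ k))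
    (g := fun t => F (x + z) t - F (x + z + a) t) _ _ _ _))//.
  - by apply: L1funB.
  - by apply: L1funB.
  - by move=> t; rewrite /D opprB.
  - rewrite lerD//; first exact: F_up.
    rewrite (@eq_L1norm _ _ _ mu _ (D z)) ?F_up// => t.
    by rewrite /D distrC.
rewrite sum_cst_seq sY natrM le_eqVlt; apply/orP; left; apply/eqP.
by field; rewrite k0 Z0.
Qed.

(* The shifts along which the difference quotient of the average must be almost
   constant for the increment over [pair_mass l] to split into its pairs. *)
Fixpoint pair_shifts (l : seq (V * V)) : seq A :=
  if l is p :: l' then (pair_mass l' - delta p.2) :: pair_shifts l' else [::].

(** The pairs are split off one by one. The increment by [delta p.1 - delta p.2] at
    [x + pair_mass l] is compared with the one at [x + delta p.2]; the base points differ by the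
    shift recorded in [pair_shifts]. *)
Lemma box_avg_additive (Y : seq A) (k : nat) (l : seq (V * V)) : (0 < size Y)%N ->
  (forall c, c \in pair_shifts l -> exists Z : seq A,
      size Y = (k * size Z)%N /\
      forall h : A -> R,
        \sum_(y <- Y) h y = \sum_(z <- Z) \sum_(i < k) h (z + c *+ i)) ->
  forall x,
  N (fun t => box_avg Y (x + pair_mass l) t - box_avg Y x t) <=
  N (fun t => \sum_(p <- l)
     (box_avg Y (x + delta p.1) t - box_avg Y (x + delta p.2) t)) +
  (\sum_(p <- l) 2 * up (delta p.1 - delta p.2)) / k%:R.
Proof.
move=> Y0 Yl x; set G := box_avg Y.
have GL y : L1fun mu (G y) by exact: box_avg_L1.
pose S l t := \sum_(p <- l) (G (x + delta p.1) t - G (x + delta p.2) t).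
have SL l' : L1fun mu (S l') by apply: L1fun_sum => p; apply: L1funB.
have {Yl} : N (fun t => G (x + pair_mass l) t - G x t - S l t) <=
    (\sum_(p <- l) 2 * up (delta p.1 - delta p.2)) / k%:R.
  elim: l Yl => [|p l IH] Yl.
    rewrite big_nil mul0r /pair_mass big_nil addr0.
    (* The function is 0 here, so an empty sum bounds its seminorm; [F 0] only fills the place of
       the summands. *)
    have := @L1norm_sum _ _ _ mu unit [::] (fun=> 0) (fun=> F 0)
      (fun t => G x t - G x t - S [::] t).
    rewrite big_nil; apply => //.
      by apply: L1funB; [exact: L1funB | exact: SL].
    by move=> t; rewrite subrr /S big_nil subrr big_nil.
  have [|Z [sZ hZ]] := Yl (pair_mass l - delta p.2); first by rewrite inE eqxx.
  have {}IH : N (fun t => G (x + pair_mass l) t - G x t - S l t) <=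
    (\sum_(p <- l) 2 * up (delta p.1 - delta p.2)) / k%:R.
    by apply: IH => c cl; apply: Yl; rewrite inE cl orbT.
  have := box_avg_diff_shift Y0 sZ hZ (x + delta p.2) (delta p.1 - delta p.2).
  rewrite [x + delta p.2 + (pair_mass l - _)]addrACA subrr addr0.
  rewrite [x + delta p.2 + (delta p.1 - _)]addrACA subrr addr0 => H.
  rewrite big_cons mulrDl [leRHS]addrC; apply: (le_trans _ (lerD IH H)).
  apply: L1norm_triangle.
  - by apply: L1funB; [exact: L1funB | exact: SL].
  - by apply: L1funB; exact: L1funB.
  - by apply: L1funB; [exact: L1funB | exact: SL].
  - move=> t; rewrite {1}/S big_cons -/(S l t) /pair_mass big_cons -/(pair_mass l).
    rewrite [x + pair_mass l + _]addrAC addrA [x + _ + pair_mass l]addrAC -/G.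
    rewrite [x + pair_mass l + _]addrAC.
    by rewrite [x + (_ - _)]addrA; ring.
move=> H; rewrite (le_trans _ (lerD (lexx (N (S l))) H))//.
apply: L1norm_triangle; [exact: SL| | exact: L1funB |].
- by apply: L1funB; [exact: L1funB | exact: SL].
- by move=> t; ring.
Qed.

Lemma box_avg_telescope (Y : seq A) (a z : A) (k : nat) :
  N (fun t => box_avg Y (z + a *+ k) t - box_avg Y z t) <=
  \sum_(i < k) N (fun t => box_avg Y (z + a *+ i + a) t - box_avg Y (z + a *+ i) t).
Proof.
set G := box_avg Y.
have GL y : L1fun mu (G y) by exact: box_avg_L1.
under eq_bigr do rewrite -[N _]mul1r.
apply: L1norm_sum => //.
- by move=> i; apply: L1funB.
- by apply: L1funB.
move=> t; under eq_bigr do rewrite mul1r -addrA -mulrSr.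
rewrite -(big_mkord xpredT (fun i => G (z + a *+ i.+1) t - G (z + a *+ i) t)).
by rewrite telescope_sumr// mulr0n addr0.
Qed.

(* At a large scale [m] the average [box_avg Y F] is almost additive, hence
   [v |-> box_avg Y F (x + delta v) t] can be fed to the scalar inequality; at
   a still larger scale [k] it is indistinguishable from [F], whence the lower
   bound. *)
Theorem L1_linearization (I : eqType) (J : seq I) (w : I -> R)
    (l : I -> seq (V * V)) (lo : I -> R)
    (E : finType) (c : E -> R) (p : E -> V * V) :
  (forall j, 0 <= w j) -> (forall e, 0 <= c e) ->
  (forall f : V -> R,
     \sum_(j <- J) w j * `|\sum_(q <- l j) (f q.1 - f q.2)| <=
     \sum_e c e * `|f (p e).1 - f (p e).2|) ->
  (forall j, j \in J -> forall k x,
     k%:R * lo j <= N (fun t => F (x + pair_mass (l j) *+ k) t - F x t)) ->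
  \sum_(j <- J) w j * lo j <= \sum_e c e * up (delta (p e).1 - delta (p e).2).
Proof.
move=> w0 c0 scalar lower; set U := \sum_e _.
pose err := \sum_(j <- J) w j * \sum_(q <- l j) 2 * up (delta q.1 - delta q.2).
apply: (@le_of_le_add_inv _ _ _ err) => m.
(* First scale: a box of side [m.+1] in all shift directions makes the average additive up to
   [err / m.+1]. *)
have [Y [Y0 YP]] := box_sum_decomposition R
  (flatten [seq pair_shifts (l j) | j <- J]) (ltn0Sn m).
set G := box_avg Y; pose rho := \sum_(y <- Y) (size Y)%:R^-1 * up y.
have GL y : L1fun mu (G y) by exact: box_avg_L1.
have G_scale x : \sum_(j <- J) w j *
    N (fun t => G (x + pair_mass (l j)) t - G x t) <= U + err / m.+1%:R.
  have H : \sum_(j <- J) w j * N (fun t => \sum_(q <- l j)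
      (G (x + delta q.1) t - G (x + delta q.2) t)) <= U.
    apply: (@le_trans _ _ (\sum_e c e * N (fun t =>
        G (x + delta (p e).1) t - G (x + delta (p e).2) t))).
      apply: L1norm_le_sum.
      - by move=> j; apply: L1fun_sum => q; apply: L1funB.
      - by move=> e; apply: L1funB.
      - by move=> t; exact: scalar (fun v => G (x + delta v) t).
    apply: ler_sum => e _; apply: ler_wpM2l => //.
    have := box_avg_up (x + delta (p e).2) (delta (p e).1 - delta (p e).2) Y0.
    by rewrite addrACA subrr addr0.
  apply: (le_trans _ (lerD H (lexx _))); rewrite /err mulr_suml -big_split /=.
  rewrite big_seq [leRHS]big_seq; apply: ler_sum => j jJ.
  rewrite -mulrA -mulrDr ler_wpM2l//.
  apply: box_avg_additive => // a al; apply: YP.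
  by apply/flattenP; exists (pair_shifts (l j)) => //; apply: map_f.
(* [rho] bounds the distance from [G] to [F] everywhere, so the lower bound at scale [k] loses only
   [2 * rho], whatever [k] is. *)
have G_lower j k x : j \in J ->
    k%:R * lo j - 2 * rho <=
    N (fun t => G (x + pair_mass (l j) *+ k) t - G x t).
  move=> jJ; set a := pair_mass (l j) *+ k.
  have := lower j jJ k x; rewrite -/a => H.
  have H1 := box_avg_close x Y0; have H2 := box_avg_close (x + a) Y0.
  rewrite -/G -/rho in H1 H2.
  have H3 : N (fun t => F (x + a) t - F x t) <=
      N (fun t => F (x + a) t - G x t) + N (fun t => G x t - F x t).
    apply: L1norm_triangle; try by [exact: L1funB].
    by move=> t; ring.
  have H4 : N (fun t => F (x + a) t - G x t) <=
      N (fun t => F (x + a) t - G (x + a) t) + N (fun t => G (x + a) t - G x t).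
    apply: L1norm_triangle; try by [exact: L1funB].
    by move=> t; ring.
  have H5 : N (fun t => F (x + a) t - G (x + a) t) =
            N (fun t => G (x + a) t - F (x + a) t).
    by apply: eq_L1norm => t; rewrite distrC.
  lra.
apply: (@le_of_le_add_inv _ _ _ (\sum_(j <- J) w j * (2 * rho))) => k.
(* Second scale: [G_scale] is averaged over a box of side [k.+1] in the directions of the molecules.
   The [k.+1] increments of [G] along a progression add up to one increment of scale [k.+1], so each
   loses only [2 * rho / k.+1] on average. *)
have [B [B0 BP]] := box_sum_decomposition R
  [seq pair_mass (l j) | j <- J] (ltn0Sn k).
have B0' : 0 < (size B)%:R :> R by rewrite ltr0n.
rewrite -(ler_pM2r B0').
have H : \sum_(b <- B) \sum_(j <- J) w j *
    N (fun t => G (b + pair_mass (l j)) t - G b t) <=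
    (U + err / m.+1%:R) * (size B)%:R.
  apply: (@le_trans _ _ (\sum_(b <- B) (U + err / m.+1%:R))).
    by apply: ler_sum => b _.
  by rewrite sum_cst_seq mulrC.
rewrite mulrDl -lerBlDr; apply: le_trans H.
rewrite exchange_big /= -mulrA mulr_suml mulr_suml -sumrB.
rewrite [leLHS]big_seq [leRHS]big_seq; apply: ler_sum => j jJ.
rewrite -mulr_sumr -[_ * lo j * _]mulrA -[w j * (2 * rho) * _]mulrA -mulrBr ler_wpM2l//.
have [Z [sZ hZ]] := BP _ (map_f (fun j => pair_mass (l j)) jJ).
rewrite hZ sZ.
apply: (@le_trans _ _ (\sum_(z <- Z) (k.+1%:R * lo j - 2 * rho))); last first.
  apply: ler_sum => z _.
  apply: le_trans (box_avg_telescope _ _ _ _).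
  exact: G_lower.
rewrite sum_cst_seq natrM le_eqVlt; apply/orP; left; apply/eqP.
have : k.+1%:R != 0 :> R by rewrite pnatr_eq0.
by move: (k.+1%:R) => K K0; field.
Qed.

End Linearization.

(** * Cuts and random signs *)

(** When a level of [f] is peeled off, the left side is subadditive and the right side additive, so
    the inequalities for indicators add up to the one for [f]. *)
Lemma cut_inequality_functions (R : realType) (V : finType) (I : Type)
    (J : seq I) (w : I -> R) (l : I -> seq (V * V))
    (E : finType) (c : E -> R) (p : E -> V * V) :
  (forall j, 0 <= w j) ->
  (forall S : V -> bool,
     \sum_(j <- J) w j * `|\sum_(q <- l j) ((S q.1)%:R - (S q.2)%:R)| <=
     \sum_e c e * `|(S (p e).1)%:R - (S (p e).2)%:R|) ->
  forall f : V -> R,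
     \sum_(j <- J) w j * `|\sum_(q <- l j) (f q.1 - f q.2)| <=
     \sum_e c e * `|f (p e).1 - f (p e).2|.
Proof.
move=> w0 cut.
(* Layer-cake induction: peel off the lowest positive level of [f]. *)
have pos (k : nat) : forall f : V -> R, (forall v, 0 <= f v) ->
    (#|[pred v | (0 < f v)%R]| <= k)%N ->
     \sum_(j <- J) w j * `|\sum_(q <- l j) (f q.1 - f q.2)| <=
     \sum_e c e * `|f (p e).1 - f (p e).2|.
  elim: k => [|k IH] f f0 fk.
    have fE v : f v = 0.
      apply/eqP; rewrite eq_le f0 andbT leNgt; apply/negP => fv.
      by move: fk; rewrite leqn0 => /eqP/card0_eq/(_ v); rewrite inE fv.
    under eq_bigr do under eq_bigr do rewrite !fE subrr.
    rewrite big1; last by move=> j _; rewrite big1 // normr0 mulr0.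
    by rewrite big1 // => e _; rewrite !fE subrr normr0 mulr0.
  have [/existsP[v0 v0P]|] := boolP [exists v, 0 < f v]; last first.
    rewrite negb_exists => /forallP fN; apply: IH => //.
    by rewrite (eq_card0 (A := [pred v | 0 < f v])) // => v; rewrite inE (negbTE (fN v)).
  pose v1 := [arg min_(v < v0 | 0 < f v) f v]%O.
  have [v1P v1min] : 0 < f v1 /\ forall v, 0 < f v -> f v1 <= f v.
    by rewrite /v1; case: arg_minP.
  pose S v := 0 < f v; pose a := f v1; pose g v := f v - a * (S v)%:R.
  have fE v : f v = g v + a * (S v)%:R by rewrite subrK.
  have g0 v : 0 <= g v.
    rewrite /g; have [Sv|] := boolP (S v); last by rewrite mulr0 subr0.
    by rewrite mulr1 subr_ge0 v1min.
  have gS v : ~~ S v -> g v = 0.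
    move=> Sv; rewrite /g (negbTE Sv) mulr0 subr0; apply/eqP.
    by rewrite eq_le f0 andbT leNgt.
  have gk : (#|[pred v | (0 < g v)%R]| <= k)%N.
    rewrite -ltnS; apply: leq_trans fk; apply: proper_card.
    rewrite properE; apply/andP; split.
      apply/fintype.subsetP => v; rewrite !inE => gv.
      by apply: contraLR gv => /gS ->; rewrite ltxx.
    apply/fintype.subsetPn; exists v1; rewrite !inE //.
    by rewrite /g /S v1P mulr1 subrr ltxx.
  have {IH}H1 := IH g g0 gk.
  have H2 := ler_wpM2l (ltW v1P) (cut S); rewrite -/a in H2.
  apply: (@le_trans _ _ (\sum_(j <- J) w j * `|\sum_(q <- l j) (g q.1 - g q.2)| +
     a * \sum_(j <- J) w j * `|\sum_(q <- l j) ((S q.1)%:R - (S q.2)%:R)|)).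
    rewrite mulr_sumr -big_split /=; apply: ler_sum => j _.
    rewrite mulrCA -mulrDr ler_wpM2l//.
    rewrite -[X in _ + X * _](ger0_norm (ltW v1P)) -normrM.
    apply: le_trans (ler_normD _ _).
    rewrite mulr_sumr -big_split /= le_eqVlt; apply/orP; left; apply/eqP.
    by congr `| _ |; apply: eq_bigr => q _; rewrite /g /a; ring.
  (* Additivity on the right: [g] is nonnegative and vanishes off [S], so across an edge the
     differences of [g] and of the indicator of [S] never have opposite signs. *)
  apply: (le_trans (lerD H1 H2)); rewrite mulr_sumr -big_split /=.
  apply: ler_sum => e _; rewrite mulrCA -mulrDr le_eqVlt; apply/orP; left; apply/eqP.
  congr (_ * _); rewrite (fE (p e).1) (fE (p e).2).
  have := g0 (p e).1; have := g0 (p e).2; have := v1P; rewrite -/a.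
  have := @gS (p e).1; have := @gS (p e).2.
  case: (S (p e).1); case: (S (p e).2) => /= G2 G1 a0 ga gb.
  - by rewrite subrr normr0 mulr0 addr0; congr `| _ |; ring.
  - rewrite G2// mulr0 mulr1 !addr0 !subr0 normr1 mulr1.
    by rewrite !ger0_norm//; apply: addr_ge0 => //; exact: ltW.
  - rewrite G1// mulr0 mulr1 !add0r !normrN normr1 mulr1.
    by rewrite !ger0_norm//; apply: addr_ge0 => //; exact: ltW.
  - by rewrite subrr normr0 !mulr0 !addr0.
(* Adding the constant [b] makes [f] nonnegative and changes no difference. *)
move=> f; pose b := \sum_v `|f v|.
have := pos #|V| (fun v => f v + b).
have bK u v : f u + b - (f v + b) = f u - f v by ring.
under eq_bigr do under eq_bigr do rewrite bK.
under [X in _ -> _ -> _ <= X]eq_bigr do rewrite bK.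
apply; last exact: max_card.
move=> v; rewrite /b (bigD1 v)//= addrA addr_ge0 ?sumr_ge0//.
by have := ler_norm (- f v); rewrite normrN; lra.
Qed.

Fixpoint signs (k : nat) : seq (seq bool) :=
  if k is k'.+1 then map (cons true) (signs k') ++ map (cons false) (signs k')
  else [:: [::]].

(** A sign is realised by swapping a pair, so a signed sum of molecules is again given by a list of
    pairs. *)
Definition flip_pairs (V : Type) (s : seq bool) (l : seq (V * V)) : seq (V * V) :=
  [seq if b.1 then b.2 else (b.2.2, b.2.1) | b <- zip s l].

Lemma size_signs k : size (signs k) = (2 ^ k)%N.
Proof. by elim: k => //= k IH; rewrite size_cat !size_map IH expnS mul2n addnn. Qed.

Lemma size_mem_signs k s : s \in signs k -> size s = k.
Proof.
elim: k s => [|k IH] s /=; first by rewrite inE => /eqP ->.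
by rewrite mem_cat => /orP[] /mapP[s' /IH <- ->].
Qed.

(** Independent signs are orthogonal, so the mixed terms cancel; [c] carries the terms whose signs
    are already chosen through the induction. *)
Lemma sum_signs_sqr (R : realType) (V : Type) (f : V -> R) (l : seq (V * V)) (c : R) :
  \sum_(s <- signs (size l)) (c + \sum_(q <- flip_pairs s l) (f q.1 - f q.2)) ^+ 2 =
  2 ^+ size l * (c ^+ 2 + \sum_(q <- l) (f q.1 - f q.2) ^+ 2).
Proof.
elim: l c => [|p l IH] c; first by rewrite /= big_seq1 /flip_pairs !big_nil mul1r !addr0.
rewrite /= big_cat !big_map /=.
under eq_bigr do rewrite /flip_pairs /= big_cons addrA -/(flip_pairs _ _).
rewrite IH.
under eq_bigr do rewrite /flip_pairs /= big_cons addrA -/(flip_pairs _ _) /=.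
by rewrite IH big_cons [2 ^+ _.+1]exprS; ring.
Qed.

(** The first moment is bounded by the second through [|X| <= (X ^ 2 / b + b) / 2], which is best at
    [b = r]. *)
Lemma sum_signs_norm (R : realType) (V : Type) (f : V -> R) (l : seq (V * V)) :
  \sum_(s <- signs (size l)) `|\sum_(q <- flip_pairs s l) (f q.1 - f q.2)| <=
  2 ^+ size l * Num.sqrt (\sum_(q <- l) (f q.1 - f q.2) ^+ 2).
Proof.
have := sum_signs_sqr f l 0; rewrite expr0n add0r.
under eq_bigr do rewrite add0r.
set m := \sum_(q <- l) _; set r := Num.sqrt m => H.
have m0 : 0 <= m by apply: sumr_ge0 => q _; exact: sqr_ge0.
have rE : r ^+ 2 = m by rewrite sqr_sqrtr.
have amgm b : 0 < b ->
    \sum_(s <- signs (size l)) `|\sum_(q <- flip_pairs s l) (f q.1 - f q.2)| <=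
    2 ^+ size l * ((m / b + b) / 2).
  move=> b0.
  have -> : 2 ^+ size l * ((m / b + b) / 2) = \sum_(s <- signs (size l))
     ((\sum_(q <- flip_pairs s l) (f q.1 - f q.2)) ^+ 2 / b + b) / 2.
    rewrite -mulr_suml big_split /= sum_cst_seq size_signs -mulr_suml H natrX.
    by ring.
  apply: ler_sum => s _; set X := \sum_(q <- _) _.
  rewrite ler_pdivlMr// -lerBlDr ler_pdivlMr// -[X ^+ 2]real_normK ?num_real//.
  rewrite -subr_ge0 (_ : _ - _ = (`|X| - b) ^+ 2); first exact: sqr_ge0.
  by ring.
have [r0|r0] := boolP (0 < r).
  have := amgm r r0; rewrite -rE expr2 mulfK ?gt_eqF//.
  by rewrite (_ : (r + r) / 2 = r)//; field.
have {}r0 : r = 0 by apply/eqP; rewrite eq_le sqrtr_ge0 andbT leNgt.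
(* For [r = 0] the bounds with [b = 1 / k.+1] tend to 0. *)
rewrite r0 mulr0; apply: (@le_of_le_add_inv _ _ _ (2 ^+ size l / 2)) => k.
have := amgm k.+1%:R^-1 _; rewrite -rE r0 expr0n mul0r !add0r invr_gt0 ltr0n.
by move=> /(_ isT); rewrite mulrCA mulrC mulrAC.
Qed.

(** * Square roots along a binary forest *)

Lemma sqrt_nat_le (R : realType) (A B m : nat) : (B <= 2 * A + m)%N ->
  Num.sqrt B%:R <= Num.sqrt 2 * Num.sqrt A%:R + m%:R :> R.
Proof.
move=> BA; set s := _ + _.
have s2 : 0 <= Num.sqrt 2 * Num.sqrt A%:R :> R by rewrite mulr_ge0 ?sqrtr_ge0.
have s0 : 0 <= s by rewrite addr_ge0.
rewrite -(ger0_norm s0) -sqrtr_sqr ler_wsqrtr//.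
rewrite /s sqrrD exprMn !sqr_sqrtr// -natrX.
apply: (@le_trans _ _ (2 * A + m)%:R); first by rewrite ler_nat.
rewrite natrD natrM lerD//; last first.
  by rewrite ler_nat; case: (m) => // m'; rewrite expnS leq_pmulr.
by rewrite lerDl mulrn_wge0// mulr_ge0.
Qed.

(** [N i] counts the inner nodes and [x i] the leaves of generation [i]; nodes in excess of the
    [2 * N i] children are new roots. One generation multiplies the weighted square root by at most
    [sqrt 2 / 2], up to the weight of the new roots, and a geometric series results. *)
Lemma binary_tree_sqrt_sum (R : realType) (n : nat) (N x : nat -> nat) :
  (forall i, 2 * N i <= N i.+1 + x i.+1)%N -> N n = 0%N ->
  (1 - Num.sqrt 2 / 2) * \sum_(i < n) 2^-1 ^+ i * Num.sqrt (N i)%:R <=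
  \sum_(i < n.+1) 2^-1 ^+ i * (x i)%:R :> R.
Proof.
move=> NP Nn.
pose y i : R := 2^-1 ^+ i * Num.sqrt (N i)%:R.
(* The last term is the weight of the inner nodes whose children are not yet counted; it telescopes,
   and at [j = n] it vanishes. *)
have key j : \sum_(i < j.+1) y i <= Num.sqrt 2 / 2 * \sum_(i < j) y i +
    \sum_(i < j.+1) 2^-1 ^+ i * (x i)%:R + 2^-1 ^+ j * (N j)%:R.
  elim: j => [|j IH].
    rewrite !big_ord_recr !big_ord0 /= /y !expr0 !mul1r mulr0 !add0r.
    have := @sqrt_nat_le R 0 (N 0) (N 0) _; rewrite sqrtr0 mulr0 add0r.
    by move=> /(_ (leqnn _)) /le_trans; apply; rewrite lerDr.
  rewrite big_ord_recr [X in _ <= _ * X + _ + _]big_ord_recr /=.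
  rewrite [X in _ <= _ + X + _]big_ord_recr /=.
  move: IH; set Y1 := \sum_(i < j.+1) y i; set Y0 := \sum_(i < j) y i.
  set X1 := \sum_(i < j.+1) _.
  have : y j.+1 <= Num.sqrt 2 / 2 * y j + 2^-1 ^+ j.+1 * (x j.+1)%:R +
      2^-1 ^+ j.+1 * (N j.+1)%:R - 2^-1 ^+ j * (N j)%:R.
    rewrite /y; set a := 2^-1 ^+ j.+1.
    have -> : 2^-1 ^+ j = 2 * a :> R by rewrite /a exprS mulVKf// pnatr_eq0.
    have a0 : 0 <= a by rewrite exprn_ge0.
    have := @sqrt_nat_le R (N j) (N j.+1) (N j.+1 + x j.+1 - 2 * N j) _.
    rewrite subnKC// leq_addr => /(_ isT).
    rewrite natrB// natrD natrM => /(ler_wpM2l a0) /le_trans; apply.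
    rewrite le_eqVlt; apply/orP; left; apply/eqP.
    by field.
  rewrite [Y1](_ : _ = Y0 + y j); first by lra.
  by rewrite /Y1 big_ord_recr.
have := key n; rewrite big_ord_recr /= {2}/y Nn sqrtr0 !mulr0 !addr0.
by rewrite -/(y _); lra.
Qed.

(** * Slash powers *)

Definition crosses (R : realType) (G : stgraph R) (S : vert G -> bool)
  (e : edge G) : bool := S (src e) != S (tgt e).

Definition edge_lipschitz (R : realType) (G : stgraph R) (g : vert G -> R) : Prop :=
  forall e : edge G, `|g (src e) - g (tgt e)| <= len e.

(** Connectedness in terms of cuts passes easily through gluing. It ensures that the infimum in
    [dist] runs over a nonempty set of walks. *)
Definition st_connected (R : realType) (G : stgraph R) : Prop :=
  forall S : vert G -> bool, (forall e : edge G, S (src e) = S (tgt e)) ->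
  forall x y, S x = S y.

Section SlashProduct.
Context {R : realType} {G H : stgraph R}.
Hypothesis st_neq : sv H != tv H.

Lemma emb_sl_sv (e : edge G) : emb_sl e (sv H) = inl (src e).
Proof. by rewrite /emb_sl insubN ?eqxx. Qed.

Lemma emb_sl_tv (e : edge G) : emb_sl e (tv H) = inl (tgt e).
Proof. by rewrite /emb_sl insubN ?eqxx ?andbF// eq_sym (negbTE st_neq). Qed.

Lemma emb_sl_inner (e : edge G) (x : inner H) : emb_sl e (val x) = inr (e, x).
Proof. by rewrite /emb_sl valK. Qed.

(** Glues a function on the old vertices with one function per block; they fit together when the
    values at both ends of each block agree. *)
Definition slash_extend (g : vert G -> R) (b : edge G -> vert H -> R)
    (x : vert (slash G H)) : R :=
  match x with inl v => g v | inr y => b y.1 (val y.2) end.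

Lemma slash_extend_emb g b : (forall e, b e (sv H) = g (src e)) ->
  (forall e, b e (tv H) = g (tgt e)) ->
  forall (e : edge G) x, slash_extend g b (emb_sl e x) = b e x.
Proof.
move=> bs bt e x; have [x0|] := boolP ((x != sv H) && (x != tv H)).
  have -> : x = val (Sub x x0 : inner H) by [].
  by rewrite emb_sl_inner.
rewrite negb_and !negbK => /orP[] /eqP ->.
  by rewrite emb_sl_sv bs.
by rewrite emb_sl_tv bt.
Qed.

Lemma slash_connected : st_connected G -> st_connected H ->
  st_connected (slash G H).
Proof.
move=> cG cH S Se.
have block e x y : S (emb_sl e x) = S (emb_sl e y).
  by apply: (cH (fun x => S (emb_sl e x))) => h; exact: (Se (e, h)).
have base x y : S (inl x) = S (inl y).
  apply: (cG (fun x => S (inl x))) => e.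
  by rewrite -emb_sl_sv -emb_sl_tv; exact: block.
have red x : exists y, S x = S (inl y).
  case: x => [y|[e y]]; first by exists y.
  by exists (src e); rewrite -emb_sl_sv -emb_sl_inner; exact: block.
by move=> x y; have [x' ->] := red x; have [y' ->] := red y.
Qed.

End SlashProduct.

Section SlashPower.
Context {R : realType} (H : stgraph R).
(** [H] enters through these data and the hypotheses on them: [cyc] marks the cycle, [u] and [w]
    stand for the tops of its sides, [psi] climbs from 0 to 1 between the terminals, and [phi]
    vanishes at both, is flat along the handle and gains at least [kappa] from [w] to [u]. *)
Variables (cyc : edge H -> bool) (u w : vert H) (kappa : R).
Variables (psi phi : vert H -> R).

(* [2^-depth e] is the thickness of [e]; only the edges of the cycle, marked by
   [cyc], halve the thickness. *)
Fixpoint depth (n : nat) : edge (spow H n) -> nat :=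
  match n return edge (spow H n) -> nat with
  | 0 => fun _ => 0
  | n'.+1 => fun e => (depth e.1 + cyc e.2)%N
  end.

(* The copies of [(u, w)] in the blocks of all edges of depth [i], whatever
   the stage at which these edges appear. *)
Fixpoint pairs_at (n i : nat) : seq (vert (spow H n) * vert (spow H n)) :=
  match n return seq (vert (spow H n) * vert (spow H n)) with
  | 0 => [::]
  | n'.+1 => [seq (inl q.1, inl q.2) | q <- pairs_at n' i] ++
             [seq (emb_sl e u, emb_sl e w)
               | e <- enum (edge (spow H n')) & depth e == i]
  end.

Fixpoint len_at (n i : nat) : R :=
  if n is n'.+1 then
    len_at n' i + \sum_(e : edge (spow H n')) (depth e == i)%:R * len e
  else 0.

Definition ncross n (S : vert (spow H n) -> bool) (i : nat) : nat :=
  (\sum_(e : edge (spow H n)) ((depth e == i) && crosses S e))%N.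

Definition ncross_block (b : bool) (S : vert H -> bool) : nat :=
  (\sum_(h : edge H) ((cyc h == b) && crosses S h))%N.

Hypothesis st_neq : sv H != tv H.
Hypothesis len_ge0 : forall h : edge H, 0 <= len h.
Hypothesis th_cyc : forall h : edge H, th h = 2^-1 ^+ cyc h.
Hypothesis mass_H : \sum_(h : edge H) th h * len h = 1.
Hypothesis cross_st : forall S : vert H -> bool, S (sv H) != S (tv H) ->
  (0 < ncross_block false S)%N || (1 < ncross_block true S)%N.
Hypothesis cross_uw : forall S : vert H -> bool, S u != S w ->
  (1 < ncross_block true S)%N.
Hypothesis H_connected : st_connected H.
Hypothesis psi_lip : edge_lipschitz psi.
Hypothesis psi_sv : psi (sv H) = 0.
Hypothesis psi_tv : psi (tv H) = 1.
Hypothesis phi_lip : edge_lipschitz phi.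
Hypothesis phi_sv : phi (sv H) = 0.
Hypothesis phi_tv : phi (tv H) = 0.
Hypothesis phi_handle : forall h : edge H, ~~ cyc h -> phi (src h) = phi (tgt h).
Hypothesis phi_uw : kappa <= phi u - phi w.

(** * Depth, thickness and mass *)

Lemma depth_le n (e : edge (spow H n)) : (depth e <= n)%N.
Proof.
elim: n e => // n IH [e h] /=; rewrite -addn1 leq_add//; last by case: (cyc h).
Qed.

Lemma th_depth n (e : edge (spow H n)) : th e = 2^-1 ^+ depth e.
Proof. by elim: n e => // n IH [e h] /=; rewrite IH th_cyc exprD. Qed.

Lemma len_spow_ge0 n (e : edge (spow H n)) : 0 <= len e.
Proof. by elim: n e => [|n IH] [] //= e h; rewrite mulr_ge0. Qed.

(** The total of thickness times length is multiplicative under the slash product. *)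
Lemma mass_spow n : \sum_(e : edge (spow H n)) th e * len e = 1.
Proof.
elim: n => [|n IH].
  by rewrite (big_pred1 tt) /= ?mulr1 // => -[].
have -> : \sum_(e : edge (spow H n.+1)) th e * len e =
    \sum_(x : edge (spow H n) * edge H) (th x.1 * len x.1) * (th x.2 * len x.2).
  by apply: eq_bigr => -[e h] _ /=; rewrite mulrACA.
rewrite -(pair_bigA _ (fun e h => th e * len e * (th h * len h))) /=.
under eq_bigr do rewrite -mulr_sumr mass_H mulr1.
exact: IH.
Qed.

Lemma sum_by_depth n m (F : edge (spow H n) -> R) : (n < m)%N ->
  \sum_(i < m) 2^-1 ^+ i * (\sum_e (depth e == i)%:R * F e) = \sum_e th e * F e.
Proof.
move=> nm; under eq_bigr do rewrite mulr_sumr.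
rewrite exchange_big /=; apply: eq_bigr => e _.
have em : (depth e < m)%N by apply: leq_ltn_trans nm; exact: depth_le.
rewrite (bigD1 (Ordinal em))//= eqxx mul1r -th_depth big1 ?addr0// => i ine.
suff -> : (depth e == i) = false by rewrite mul0r mulr0.
by apply: contraNF ine => /eqP ei; apply/eqP/val_inj.
Qed.

(** Each of the [n] stages contributes the whole mass 1, distributed over the depths. *)
Lemma len_at_sum n : \sum_(i < n) 2^-1 ^+ i * len_at n i = n%:R.
Proof.
suff H0 m : (n <= m)%N -> \sum_(i < m) 2^-1 ^+ i * len_at n i = n%:R by exact: H0.
elim: n => [|n IH] nm; first by rewrite big1 // => i _; rewrite mulr0.
under eq_bigr do rewrite /= mulrDr.
rewrite big_split /= IH 1?ltnW// sum_by_depth// mass_spow.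
by rewrite natr1.
Qed.

(** An edge of depth [i.+1] is a handle edge in the block of an edge of depth [i.+1], or a cycle
    edge in the block of one of depth [i]. *)
Lemma ncrossS n (S : vert (spow H n.+1) -> bool) i :
  ncross S i.+1 = (\sum_(e : edge (spow H n))
     ((depth e == i.+1) * ncross_block false (fun x => S (emb_sl e x)) +
      (depth e == i) * ncross_block true (fun x => S (emb_sl e x))))%N.
Proof.
have -> : ncross S i.+1 = (\sum_(x : edge (spow H n) * edge H)
    ((depth x.1 + cyc x.2 == i.+1) && crosses (fun y => S (emb_sl x.1 y)) x.2))%N.
  by [].
rewrite -(pair_bigA _ (fun e h => nat_of_bool
  ((depth e + cyc h == i.+1)%N && crosses (fun y => S (emb_sl e y)) h))) /=.
apply: eq_bigr => e _; rewrite !big_distrr -big_split /=; apply: eq_bigr => h _.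
case: (cyc h) => /=; rewrite ?muln0 ?addn0 ?add0n ?addn1 ?eqSS mulnb //.
Qed.

Lemma count_pairsS n (S : vert (spow H n.+1) -> bool) i :
  count (fun q => S q.1 != S q.2) (pairs_at n.+1 i) =
  (count (fun q => S (inl q.1) != S (inl q.2)) (pairs_at n i) +
   \sum_(e : edge (spow H n)) ((depth e == i) && (S (emb_sl e u) != S (emb_sl e w))))%N.
Proof.
rewrite /= count_cat !count_map count_filter; congr addn.
rewrite -sum1_count big_enum_cond /= big_mkcond; apply: eq_bigr => e _ /=.
by rewrite andbC; case: (_ && _).
Qed.

(* [N i] counts the edges of depth [i] that act as inner nodes of a binary
   forest: those whose pair is cut and those that are cut only in their cycle.
   Each of them has at least two cut descendants of depth [i + 1]. *)
Lemma crossing_forest n (S : vert (spow H n) -> bool) : exists N : nat -> nat,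
  [/\ forall i, (count (fun q => S q.1 != S q.2) (pairs_at n i) <= N i)%N,
      forall i, (2 * N i <= N i.+1 + ncross S i.+1)%N &
      forall i, (n <= i)%N -> N i = 0%N].
Proof.
elim: n S => [|n IH] S; first by exists (fun=> 0%N); split.
have [N [N1 N2 N3]] := IH (fun x => S (inl x)).
pose Se (e : edge (spow H n)) x := S (emb_sl e x).
(* [b] marks the edges of stage [n] that become inner nodes; each has two cut cycle edges as
   children. *)
pose b e := (Se e u != Se e w) ||
  ((Se e (sv H) != Se e (tv H)) && (ncross_block false (Se e) == 0%N)).
have bq e : (2 * b e <= ncross_block true (Se e))%N.
  have [/orP[/cross_uw //|/andP[/cross_st]]|//] := boolP (b e).
  by case: (ncross_block false (Se e)).
(* A cut edge that is not marked hands its place to a cut handle edge of its block, which has the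
   same depth. *)
have xb e : (crosses (fun x => S (inl x)) e <= b e + ncross_block false (Se e))%N.
  rewrite /crosses -(emb_sl_sv (H := H)) -(emb_sl_tv st_neq) /b /Se.
  case: (S (emb_sl e (sv H)) != S (emb_sl e (tv H))) => //=.
  by case: (ncross_block _ _) => [|k]; rewrite ?orbT// addnS.
exists (fun i => N i + \sum_(e : edge (spow H n)) (depth e == i) * b e)%N; split.
- move=> i; rewrite count_pairsS leq_add//; apply: leq_sum => e _.
  by case: (depth e == i); rewrite //= mul1n /b; case: (_ != _).
- move=> i; rewrite ncrossS big_split /=.
  have := N2 i.
  have : (2 * (\sum_(e : edge (spow H n)) (depth e == i) * b e) <=
      \sum_(e : edge (spow H n)) (depth e == i) * ncross_block true (Se e))%N.
    by rewrite big_distrr /=; apply: leq_sum => e _; rewrite mulnCA leq_mul.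
  have : (ncross (fun x => S (inl x)) i.+1 <=
      \sum_(e : edge (spow H n)) (depth e == i.+1) * b e +
      \sum_(e : edge (spow H n)) (depth e == i.+1) * ncross_block false (Se e))%N.
    rewrite -big_split /=; apply: leq_sum => e _.
    by case: (depth e == i.+1) => //=; rewrite !mul1n.
  by rewrite /Se; clear; lia.
- move=> i ni; rewrite N3 1?ltnW// big1 // => e _.
  by rewrite ltn_eqF// (leq_ltn_trans (depth_le e)).
Qed.

(** * Random signed sums of molecules *)

Definition signed_index (n : nat) : seq (nat * seq bool) :=
  [seq (i, s) | i <- iota 0 n, s <- signs (size (pairs_at n i))].

(** The factors are the constant of the forest bound, the thickness at depth [j.1] and the
    probability of a sign pattern. *)
Definition signed_weight (n : nat) (j : nat * seq bool) : R :=
  (1 - Num.sqrt 2 / 2) * (2^-1 ^+ j.1 * 2^-1 ^+ size (pairs_at n j.1)).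

Definition signed_pairs (n : nat) (j : nat * seq bool) :=
  flip_pairs j.2 (pairs_at n j.1).

Lemma signed_const_ge0 : 0 <= 1 - Num.sqrt 2 / 2 :> R.
Proof.
rewrite subr_ge0 ler_pdivrMr// mul1r -[leRHS]ger0_norm// -sqrtr_sqr.
by rewrite ler_wsqrtr// expr2 ler_peMl// ler1n.
Qed.

Lemma signed_weight_ge0 n j : 0 <= signed_weight n j.
Proof. by rewrite !mulr_ge0 ?exprn_ge0// signed_const_ge0. Qed.

Lemma signed_sum n (F : nat * seq bool -> R) :
  \sum_(j <- signed_index n) signed_weight n j * F j =
  (1 - Num.sqrt 2 / 2) * \sum_(i < n) 2^-1 ^+ i *
    (2^-1 ^+ size (pairs_at n i) * \sum_(s <- signs (size (pairs_at n i))) F (nat_of_ord i, s)).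
Proof.
rewrite big_allpairs_dep.
rewrite -(big_mkord xpredT (fun i => 2^-1 ^+ i * (2^-1 ^+ size (pairs_at n i) *
  \sum_(s <- signs (size (pairs_at n i))) F (i, s)))) /index_iota subn0.
rewrite mulr_sumr; apply: eq_bigr => i _; rewrite !mulr_sumr.
by apply: eq_bigr => s _; rewrite /signed_weight /= !mulrA.
Qed.

(** For an indicator the second moment of a signed sum is the number of cut pairs, at most [N i].
    The forest bound sums the square roots, and its leaves are the cut edges weighted by
    thickness. *)
Theorem signed_sobolev n (f : vert (spow H n) -> R) :
  \sum_(j <- signed_index n) signed_weight n j *
     `|\sum_(q <- signed_pairs n j) (f q.1 - f q.2)| <=
  \sum_(e : edge (spow H n)) th e * `|f (src e) - f (tgt e)|.
Proof.
apply: (cut_inequality_functions (l := signed_pairs n)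
  (p := fun e : edge (spow H n) => (src e, tgt e))); first exact: signed_weight_ge0.
move=> S /=; rewrite signed_sum.
have [N [N1 N2 N3]] := crossing_forest S.
apply: (@le_trans _ _ ((1 - Num.sqrt 2 / 2) *
    \sum_(i < n) 2^-1 ^+ i * Num.sqrt (N i)%:R)).
  rewrite ler_wpM2l ?signed_const_ge0//; apply: ler_sum => i _.
  rewrite ler_wpM2l ?exprn_ge0//.
  have := sum_signs_norm (fun v => (S v)%:R : R) (pairs_at n i).
  have half0 : 0 <= 2^-1 :> R by rewrite invr_ge0.
  move=> /(ler_wpM2l (exprn_ge0 (size (pairs_at n i)) half0)) /le_trans; apply.
  rewrite mulrA -exprMn mulVf ?pnatr_eq0// expr1n mul1r ler_wsqrtr//.
  apply: (@le_trans _ _ (count (fun q => S q.1 != S q.2) (pairs_at n i))%:R); last first.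
    by rewrite ler_nat.
  rewrite -sum1_count natr_sum [leRHS]big_mkcond /=; apply: ler_sum => q _.
  by case: (S q.1); case: (S q.2); rewrite /= ?subrr ?subr0 ?sub0r ?expr0n ?sqrrN ?expr1n.
apply: le_trans (binary_tree_sqrt_sum R N2 (N3 n (leqnn n))) _.
rewrite le_eqVlt; apply/orP; left; apply/eqP.
rewrite -(sum_by_depth _ (ltnSn n)); apply: eq_bigr => i _; congr (_ * _).
rewrite /ncross natr_sum; apply: eq_bigr => e _.
rewrite /crosses; case: (depth e == i); rewrite /= ?mul0r ?mul1r//.
by case: (S (src e)); case: (S (tgt e)); rewrite /= ?subrr ?subr0 ?sub0r ?normrN ?normr1 ?normr0.
Qed.

(** * Lipschitz functions on slash powers *)

Lemma spow_connected n : st_connected (spow H n).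
Proof.
elim: n => [|n IH]; last exact: slash_connected.
by move=> S /(_ tt) /= S01 [] [].
Qed.

Lemma spow_st_function n : exists g : vert (spow H n) -> R,
  [/\ edge_lipschitz g, g (sv (spow H n)) = 0 & g (tv (spow H n)) = 1].
Proof.
elim: n => [|n [g [gl gs gt]]].
  exists (fun b : bool => b%:R); split=> // e /=.
  by rewrite sub0r normrN normr1.
pose b (e : edge (spow H n)) x := g (src e) + (g (tgt e) - g (src e)) * psi x.
have bE := @slash_extend_emb R (spow H n) H st_neq g b.
exists (slash_extend g b); split=> // -[e h] /=.
rewrite !bE; try by [move=> e'; rewrite /b ?psi_sv ?psi_tv; ring].
rewrite /b (_ : _ - _ = (g (tgt e) - g (src e)) * (psi (src h) - psi (tgt h))).
  by rewrite normrM ler_pM// distrC gl.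
by ring.
Qed.

Lemma flip_pairs_cat (V : Type) (s : seq bool) (l1 l2 : seq (V * V)) :
  size s = size (l1 ++ l2) ->
  flip_pairs s (l1 ++ l2) =
  flip_pairs (take (size l1) s) l1 ++ flip_pairs (drop (size l1) s) l2.
Proof.
move=> ss; rewrite /flip_pairs -map_cat -zip_cat ?cat_take_drop//.
by rewrite size_takel// ss size_cat leq_addr.
Qed.

Lemma flip_pairs_map (V W : Type) (h : V -> W) (s : seq bool) (l : seq (V * V)) :
  flip_pairs s [seq (h q.1, h q.2) | q <- l] =
  [seq (h q.1, h q.2) | q <- flip_pairs s l].
Proof.
rewrite /flip_pairs -map_comp.
by elim: l s => [|q l IH] [|[] s] //=; rewrite IH.
Qed.

Lemma signs_of_index (I : eqType) (es : seq I) (s : seq bool) : uniq es ->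
  size s = size es -> s = [seq nth true s (index e es) | e <- es].
Proof.
move=> ue ss; apply: (@eq_from_nth _ true); first by rewrite size_map.
move=> k; rewrite ss => ks.
case: es ue ss ks => // e0 es ue ss ks.
by rewrite (nth_map e0)// index_uniq.
Qed.

(** The dual function witnessing that the cost of a signed sum is at least the sum of the costs.
    Flatness across edges of depth at most [i] carries the induction: the block of an edge of depth
    [i] has equal values at both ends, so a copy of [phi] with any sign fits into it. *)
Lemma signed_lipschitz n i (s : seq bool) : size s = size (pairs_at n i) ->
  exists g : vert (spow H n) -> R,
    [/\ edge_lipschitz g,
        forall e : edge (spow H n), (depth e <= i)%N -> g (src e) = g (tgt e) &
        kappa * len_at n i <= \sum_(q <- flip_pairs s (pairs_at n i)) (g q.1 - g q.2)].
Proof.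
elim: n s => [|n IH] s ss.
  exists (fun=> 0); split=> //.
  - by move=> e; rewrite subrr normr0.
  - by rewrite (size0nil ss) mulr0 /flip_pairs big_nil.
rewrite /= in ss *; rewrite flip_pairs_cat//.
set es := [seq e <- enum (edge (spow H n)) | depth e == i] in ss *.
set k := size _.
have ks : k = size (pairs_at n i) by rewrite /k size_map.
have [|g [gl gf gk]] := IH (take k s).
  by rewrite size_takel// ss size_cat -/k leq_addr.
set s2 := drop k s.
have ss2 : size s2 = size es.
  by rewrite size_drop ss size_cat -/k addKn size_map.
pose sg e : R := if nth true s2 (index e es) then 1 else -1.
pose b (e : edge (spow H n)) x := if depth e == i
  then g (src e) + sg e * len e * phi x
  else g (src e) + (g (tgt e) - g (src e)) * psi x.
have sgN e : `|sg e| = 1 by rewrite /sg; case: ifP; rewrite ?normrN normr1.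
have bE := @slash_extend_emb R (spow H n) H st_neq g b.
have bs e : b e (sv H) = g (src e).
  by rewrite /b psi_sv phi_sv !mulr0 !addr0 if_same.
have bt e : b e (tv H) = g (tgt e).
  rewrite /b psi_tv phi_tv mulr0 addr0 mulr1; case: eqP => [ei|_]; last by ring.
  by rewrite gf ?ei.
exists (slash_extend g b); split.
- move=> -[e h] /=; rewrite !bE// /b; case: ifP => _.
    rewrite (_ : _ - _ = sg e * (len e * (phi (src h) - phi (tgt h)))); last by ring.
    rewrite normrM sgN mul1r normrM ger0_norm ?len_spow_ge0//.
    by rewrite ler_wpM2l ?len_spow_ge0.
  rewrite (_ : _ - _ = (g (tgt e) - g (src e)) * (psi (src h) - psi (tgt h))).
    by rewrite normrM ler_pM// distrC gl.
  by ring.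
(* In the block of an edge of depth [i], an edge of depth at most [i] belongs to the handle, where
   [phi] is flat; in any other block the parent edge already has depth at most [i]. *)
- move=> -[e h] /= ei; rewrite !bE// /b; case: eqP => [ei'|ei'].
    by rewrite phi_handle//; move: ei; rewrite ei'; case: (cyc h) => //; rewrite addn1 ltnn.
  rewrite gf ?subrr ?mul0r//.
  by apply: leq_trans ei; rewrite leq_addr.
- rewrite big_cat /= flip_pairs_map big_map /= mulrDr lerD//.
  have -> : flip_pairs s2 [seq (emb_sl e u, emb_sl e w) | e <- es] =
      [seq if nth true s2 (index e es) then (emb_sl e u, emb_sl e w)
           else (emb_sl e w, emb_sl e u) | e <- es].
    have ues : uniq es by apply: filter_uniq; exact: enum_uniq.
    rewrite /flip_pairs {1}(signs_of_index ues ss2).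
    by rewrite zip_map -map_comp; apply: eq_map => e /=; case: nth.
  rewrite big_map big_filter big_enum_cond /= mulr_sumr [leRHS]big_mkcond /=.
  apply: ler_sum => e _; case: eqP => [ei|_]; last by rewrite mul0r mulr0.
  (* The sign [sg e] and the orientation of the pair cancel. *)
  have -> : slash_extend g b (if nth true s2 (index e es) then (emb_sl e u, emb_sl e w)
      else (emb_sl e w, emb_sl e u)).1 - slash_extend g b
      (if nth true s2 (index e es) then (emb_sl e u, emb_sl e w)
      else (emb_sl e w, emb_sl e u)).2 = len e * (phi u - phi w).
    have bi x : b e x = g (src e) + sg e * len e * phi x by rewrite /b ei eqxx.
    by rewrite /sg in bi; case: nth bi => bi /=; rewrite !bE// !bi; ring.
  by rewrite mul1r mulrC ler_wpM2l ?len_spow_ge0.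
Qed.

End SlashPower.

(** * Transportation cost *)

Section TransportCost.
Context {R : realType} {G : stgraph R}.
Hypothesis len_ge0 : forall e : edge G, 0 <= len e.

Lemma walk_len_ge0 (s : seq (edge G * bool)) : 0 <= \sum_(p <- s) len p.1.
Proof. by apply: sumr_ge0. Qed.

Lemma dist_le_walk x s y : uwalk x s y -> dist G x y <= \sum_(p <- s) len p.1.
Proof.
move=> xy; apply: ge_inf; last by exists s.
by exists 0 => _ [s' [_ ->]]; exact: walk_len_ge0.
Qed.

Lemma dist_ge0 x y : 0 <= dist G x y.
Proof.
rewrite /dist; set E := [set _ | _]%classic.
(* Without walks the infimum is 0 by convention. *)
have [E0|E0] := pselect (E !=set0)%classic; last first.
  have -> : E = set0 by apply/eqP/negPn/negP => /set0P.
  by rewrite inf0.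
by apply: lb_le_inf => // _ [s [_ ->]]; exact: walk_len_ge0.
Qed.

Lemma dist_xx x : dist G x x = 0.
Proof.
apply/eqP; rewrite eq_le dist_ge0 andbT.
by have /= := @dist_le_walk x [::] x (eqxx x); rewrite big_nil.
Qed.

Lemma dist_edge (e : edge G) : dist G (src e) (tgt e) <= len e.
Proof.
have := @dist_le_walk (src e) [:: (e, true)] (tgt e).
by rewrite /= !eqxx big_seq1; apply.
Qed.

Lemma uwalk_cat x s1 y s2 z :
  @uwalk R G x s1 y -> uwalk y s2 z -> uwalk x (s1 ++ s2) z.
Proof.
elim: s1 x => [|[e []] s1 IH] x /=; first by move=> /eqP ->.
- by move=> /andP[-> /IH +] H => /(_ H).
- by move=> /andP[-> /IH +] H => /(_ H).
Qed.

Lemma edge_lipschitz_walk g x s y : edge_lipschitz g -> @uwalk R G x s y ->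
  `|g x - g y| <= \sum_(p <- s) len p.1.
Proof.
move=> gl; elim: s x => [|[e b] s IH] x /=.
  by move=> /eqP ->; rewrite big_nil subrr normr0.
case: b => /andP[/eqP <- /IH gs]; rewrite big_cons.
  rewrite (le_trans _ (lerD (gl e) gs))// (le_trans _ (ler_normD _ _))//.
  by rewrite addrA subrK.
have {}gl := gl e; rewrite distrC in gl.
rewrite (le_trans _ (lerD gl gs))// (le_trans _ (ler_normD _ _))//.
by rewrite addrA subrK.
Qed.

Hypothesis G_connected : st_connected G.

(** No edge leaves the set of vertices reached from [x]. *)
Lemma walk_exists x y : exists s, @uwalk R G x s y.
Proof.
pose S z := `[< exists s, @uwalk R G x s z >].
have Sx : S x by apply/asboolP; exists [::]; rewrite /= eqxx.
suff : S y by move=> /asboolP.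
rewrite -(G_connected (S := S) _ x y)// => e.
apply/idP/idP => /asboolP[s xs]; apply/asboolP.
  exists (s ++ [:: (e, true)]); apply: uwalk_cat xs _; by rewrite /= !eqxx.
exists (s ++ [:: (e, false)]); apply: uwalk_cat xs _; by rewrite /= !eqxx.
Qed.

Lemma edge_lipschitz_dist g x y : edge_lipschitz g -> `|g x - g y| <= dist G x y.
Proof.
move=> gl; apply: lb_le_inf.
  by have [s xs] := walk_exists x y; exists (\sum_(p <- s) len p.1), s.
by move=> _ [s [xs ->]]; exact: edge_lipschitz_walk xs.
Qed.

Lemma dist_edge_lipschitz x : edge_lipschitz (fun y => dist G y x).
Proof.
move=> e; rewrite ler_distl; apply/andP; split.
  rewrite lerBlDr; suff : dist G (tgt e) x - len e <= dist G (src e) x by lra.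
  apply: lb_le_inf.
    by have [s xs] := walk_exists (src e) x; exists (\sum_(p <- s) len p.1), s.
  move=> _ [s [xs ->]]; have := @dist_le_walk (tgt e) ((e, false) :: s) x.
  rewrite /= eqxx xs big_cons => /(_ isT) /=; lra.
suff : dist G (src e) x - len e <= dist G (tgt e) x by lra.
apply: lb_le_inf.
  by have [s xs] := walk_exists (tgt e) x; exists (\sum_(p <- s) len p.1), s.
move=> _ [s [xs ->]]; have := @dist_le_walk (src e) ((e, true) :: s) x.
rewrite /= eqxx xs big_cons => /(_ isT) /=; lra.
Qed.

Lemma sum_delta (x : vert G) (g : vert G -> R) :
  \sum_v (x == v)%:R * g v = g x.
Proof.
rewrite (bigD1 x)//= eqxx mul1r big1 ?addr0// => v vx.
by rewrite eq_sym (negbTE vx) mul0r.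
Qed.

(** Weak duality: a Lipschitz function pairs with every representation to at most its cost. The list
    [l] itself keeps the infimum from being over the empty set. *)
Lemma tc_norm_pairing (g : vert G -> R) (l : seq (R * vert G * vert G)) :
  edge_lipschitz g -> all (fun q => 0 <= q.1.1) l ->
  \sum_(q <- l) q.1.1 * (g q.1.2 - g q.2) <=
  tc_norm (fun x => \sum_(q <- l) q.1.1 * ((q.1.2 == x)%:R - (q.2 == x)%:R)).
Proof.
move=> gl l0.
have pairing (l' : seq (R * vert G * vert G)) :
    \sum_v (\sum_(q <- l') q.1.1 * ((q.1.2 == v)%:R - (q.2 == v)%:R)) * g v =
    \sum_(q <- l') q.1.1 * (g q.1.2 - g q.2).
  under eq_bigr do rewrite mulr_suml.
  rewrite exchange_big /=; apply: eq_bigr => q _.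
  under eq_bigr do rewrite -mulrA mulrBl.
  by rewrite -mulr_sumr sumrB !sum_delta.
apply: lb_le_inf; first by exists (\sum_(q <- l) q.1.1 * dist G q.1.2 q.2), l.
move=> _ [l' [l'0 l'E ->]]; rewrite -pairing.
under eq_bigr do rewrite l'E.
rewrite pairing big_seq [leRHS]big_seq; apply: ler_sum => q ql.
rewrite ler_wpM2l ?(allP l'0)// (le_trans (ler_norm _))//.
exact: edge_lipschitz_dist.
Qed.

Lemma tc_norm_molecule (x y : vert G) :
  tc_norm (fun z => (x == z)%:R - (y == z)%:R) <= dist G x y.
Proof.
apply: ge_inf.
  exists 0 => _ [l [l0 _ ->]]; rewrite big_seq; apply: sumr_ge0 => q ql.
  by rewrite mulr_ge0 ?dist_ge0// (allP l0).
exists [:: (1, x, y)]; split; rewrite /= ?ler01//.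
- by move=> z; rewrite big_seq1 mul1r.
- by rewrite big_seq1 mul1r.
Qed.

(** Removing the total mass at the source projects the additive group of all functions, on which the
    averaging takes place, linearly onto the measures of mass 0. *)
Definition tc_vec (y : {ffun vert G -> R}) (v : vert G) : R :=
  y v - (\sum_z y z) * (sv G == v)%:R.

Lemma tc_vec_sum y : \sum_v tc_vec y v = 0.
Proof.
rewrite sumrB -mulr_sumr.
under [X in _ - _ * X]eq_bigr do rewrite -[(_ == _)%:R]mulr1.
by rewrite (sum_delta (sv G) (fun=> 1)) mulr1 subrr.
Qed.

Definition tc_of (y : {ffun vert G -> R}) : TC G := exist _ _ (tc_vec_sum y).

Lemma tc_dist_of x a : tc_dist (tc_of (x + a)) (tc_of x) = tc_norm (tc_vec a).
Proof.
rewrite /tc_dist; congr tc_norm; apply/funext => v /=; rewrite /tc_vec !ffunE.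
by under eq_bigr do rewrite ffunE; rewrite big_split /=; ring.
Qed.

Definition unit_mass (v : vert G) : {ffun vert G -> R} := [ffun x => (v == x)%:R].

Lemma tc_vec_pair_mass (l : seq (vert G * vert G)) k :
  tc_vec (pair_mass unit_mass l *+ k) =
  fun v => \sum_(q <- [seq (k%:R, p.1, p.2) | p <- l])
    q.1.1 * ((q.1.2 == v)%:R - (q.2 == v)%:R).
Proof.
apply/funext => v; rewrite big_map /=.
have E z : (pair_mass unit_mass l *+ k) z =
    \sum_(p <- l) k%:R * ((p.1 == z)%:R - (p.2 == z)%:R).
  rewrite ffunMnE /pair_mass sum_ffunE -[_ *+ k]mulr_natl mulr_sumr.
  by apply: eq_bigr => p _; rewrite !ffunE.
rewrite /tc_vec E; under [X in _ - X * _]eq_bigr do rewrite E.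
rewrite exchange_big /= [X in _ - X * _]big1 ?mul0r ?subr0// => p _.
rewrite -mulr_sumr sumrB.
have S1 x : \sum_(v : vert G) (x == v)%:R = 1 :> R.
  by have := sum_delta x (fun=> 1); under eq_bigr do rewrite mulr1.
by rewrite !S1 subrr mulr0.
Qed.

End TransportCost.

(** * Distortion of embeddings into $L_1$ *)

Section DistortionBound.
Context {R : realType} (H : stgraph R).
Variables (cyc : edge H -> bool) (u w : vert H) (kappa : R).
Variables (psi phi : vert H -> R).
Hypothesis st_neq : sv H != tv H.
Hypothesis len_ge0 : forall h : edge H, 0 <= len h.
Hypothesis th_cyc : forall h : edge H, th h = 2^-1 ^+ cyc h.
Hypothesis mass_H : \sum_(h : edge H) th h * len h = 1.
Hypothesis cross_st : forall S : vert H -> bool, S (sv H) != S (tv H) ->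
  (0 < ncross_block cyc false S)%N || (1 < ncross_block cyc true S)%N.
Hypothesis cross_uw : forall S : vert H -> bool, S u != S w ->
  (1 < ncross_block cyc true S)%N.
Hypothesis H_connected : st_connected H.
Hypothesis psi_lip : edge_lipschitz psi.
Hypothesis psi_sv : psi (sv H) = 0.
Hypothesis psi_tv : psi (tv H) = 1.
Hypothesis phi_lip : edge_lipschitz phi.
Hypothesis phi_sv : phi (sv H) = 0.
Hypothesis phi_tv : phi (tv H) = 0.
Hypothesis phi_handle : forall h : edge H, ~~ cyc h -> phi (src h) = phi (tgt h).
Hypothesis phi_uw : kappa <= phi u - phi w.

Lemma L1_embeds_spow n D : L1_embeds (@tc_dist R (spow H n)) D ->
  (1 - Num.sqrt 2 / 2) * (kappa * n%:R) <= D.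
Proof.
move=> [d [T [mu [f [r [r0 fI fb]]]]]]; pose G := spow H n.
have Glen (e : edge G) : 0 <= len e by exact: len_spow_ge0.
have Gconn : st_connected G by exact: spow_connected.
pose F (y : {ffun vert G -> R}) := f (tc_of y).
have F_L1 y : L1fun mu (F y) by exact: fI.
have intE x y : (\int[mu]_t (`|F x t - F y t|)%:E)%E =
    (L1norm mu (fun t => F x t - F y t))%:E.
  rewrite /L1norm /Rintegral fineK//; apply: integrable_fin_num => //.
  by apply: L1fun_norm; exact: L1funB.
have F_lo x a : r * tc_norm (tc_vec a) <= L1norm mu (fun t => F (x + a) t - F x t).
  by have [+ _] := fb (tc_of (x + a)) (tc_of x); rewrite tc_dist_of intE lee_fin.
have F_up x a : L1norm mu (fun t => F (x + a) t - F x t) <= D * r * tc_norm (tc_vec a).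
  by have [_ +] := fb (tc_of (x + a)) (tc_of x); rewrite tc_dist_of intE lee_fin.
(* Both bounds are compared at the molecule of sink and source, whose cost is positive. *)
have D0 : 0 <= D.
  have [g [gl gs gt]] := spow_st_function st_neq psi_lip psi_sv psi_tv n.
  have := le_trans (F_lo 0 (pair_mass (unit_mass (G := G)) [:: (tv G, sv G)] *+ 1)) (F_up _ _).
  rewrite tc_vec_pair_mass; set N := tc_norm _.
  have N1 : 1 <= N.
    have := tc_norm_pairing Gconn gl (l := [:: (1, tv G, sv G)]).
    by rewrite big_seq1 /= ler01 gs gt subr0 mulr1 => /(_ isT).
  have N0 : 0 < N by exact: lt_le_trans N1.
  rewrite ler_pM2r// ler_pMl//; exact: le_trans.
have := @L1_linearization _ _ _ mu _ (vert G) (@unit_mass R G) F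
  (fun a => D * r * tc_norm (tc_vec a)) F_L1 F_up _
  (signed_index cyc u w n) (signed_weight cyc u w n) (signed_pairs cyc u w n)
  (fun j => r * (kappa * len_at cyc n j.1))
  (edge G) th (fun e => (src e, tgt e)).
move=> /(_ (@signed_weight_ge0 _ _ cyc u w n)).
have Gth (e : edge G) : 0 <= th e by rewrite (th_depth th_cyc) exprn_ge0 ?invr_ge0.
move=> /(_ Gth (signed_sobolev st_neq th_cyc cross_st cross_uw (n := n))).
have lower j : j \in signed_index cyc u w n -> forall k x,
    k%:R * (r * (kappa * len_at cyc n j.1)) <= L1norm mu
    (fun t => F (x + pair_mass (unit_mass (G := G)) (signed_pairs cyc u w n j) *+ k) t - F x t).
  move=> /allpairsPdep[i [s [_ sP ->]]] k x /=.
  apply: le_trans (F_lo _ _); rewrite mulrCA (ler_wpM2l (ltW r0))//.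
  have [g [gl _ gk]] := signed_lipschitz st_neq len_ge0 psi_lip psi_sv psi_tv
    phi_lip phi_sv phi_tv phi_handle phi_uw (size_mem_signs sP).
  rewrite tc_vec_pair_mass /signed_pairs /=.
  have := tc_norm_pairing Gconn gl
    (l := [seq (k%:R, p.1, p.2) | p <- flip_pairs s (pairs_at cyc u w n i)]).
  rewrite all_map (eq_all (a2 := predT)) ?all_predT; last by move=> q /=; rewrite ler0n.
  move=> /(_ isT) /(le_trans _); apply.
  by rewrite big_map /= -mulr_sumr ler_wpM2l.
move=> /(_ lower) {lower}; rewrite signed_sum.
(* The lower bound is the same for all signs of one depth, so averaging over them changes nothing,
   and the weighted lengths add up to [n]. *)
rewrite [X in _ * X <= _](_ : _ = r * kappa * n%:R); last first.
  rewrite -(len_at_sum th_cyc mass_H n) mulr_sumr; apply: eq_bigr => i _ /=.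
  rewrite sum_cst_seq size_signs natrX [2^-1 ^+ size _ * _]mulrA -exprMn.
  by rewrite mulVf ?pnatr_eq0// expr1n mul1r; ring.
move=> main; rewrite -(ler_pM2l r0).
have -> : r * ((1 - Num.sqrt 2 / 2) * (kappa * n%:R)) =
    (1 - Num.sqrt 2 / 2) * (r * kappa * n%:R) by ring.
apply: (le_trans main).
(* Each edge molecule costs at most the length of the edge, and the mass is 1. *)
apply: (@le_trans _ _ (\sum_(e : edge G) D * r * (th e * len e))); last first.
  by rewrite -mulr_sumr mass_spow// mulr1 mulrC.
apply: ler_sum => e _; rewrite mulrCA (ler_wpM2l (mulr_ge0 D0 (ltW r0)))//=.
rewrite ler_wpM2l//.
have -> : tc_vec (unit_mass (G := G) (src e) - unit_mass (tgt e)) =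
    (fun z => (src e == z)%:R - (tgt e == z)%:R).
  have := @tc_vec_pair_mass R G [:: (src e, tgt e)] 1.
  rewrite /pair_mass big_seq1 mulr1n => ->.
  by apply/funext => z; rewrite /= big_seq1 mul1r.
by apply: le_trans (tc_norm_molecule _ _ _) (dist_edge _ _).
Qed.

End DistortionBound.

(** * Paths, cycles and edge replacement *)

Lemma sum_sig (R : realType) (I : finType) (P : pred I) (F : I -> R) :
  \sum_(x : {i | P i}) F (val x) = \sum_(i | P i) F i.
Proof. exact: esym (big_sub (op := +%R) P F). Qed.

Section Consecutive.
Context {T : eqType} (S : T -> bool).

Lemma mem_consec (g : seq T) p : p \in consec g -> p.1 \in g /\ p.2 \in g.
Proof.
rewrite /consec; elim: g => [|x [|y g] IH] //=.
rewrite inE => /orP[/eqP ->|/IH [p1 p2]]; first by rewrite /= !inE !eqxx orbT.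
by split; rewrite inE; apply/orP; right.
Qed.

Lemma consec_enter x g y : y \in g -> S y != S x ->
  exists2 p, p \in consec (x :: g) & S p.1 = S x /\ S p.2 != S x.
Proof.
elim: g x => [|z g IH] x //; rewrite inE => yg yx.
have [zx|zx] := boolP (S z == S x); last first.
  by exists (x, z) => //; rewrite /consec /= inE eqxx.
have [||p pg [p1 p2]] := IH z.
- by case/orP: yg => // /eqP yz; rewrite yz zx in yx.
- by rewrite (eqP zx).
exists p; first by rewrite /consec /= inE; apply/orP; right.
by rewrite -(eqP zx).
Qed.

Lemma consec_leave x g y : y \in x :: g -> S y != S (last x g) ->
  exists2 p, p \in consec (x :: g) &
    S p.1 != S (last x g) /\ S p.2 = S (last x g).
Proof.
elim: g x y => [|z g IH] x y /=.
  by rewrite inE => /eqP ->; rewrite eqxx.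
have next y' : y' \in z :: g -> S y' != S (last z g) ->
    exists2 p, p \in consec [:: x, z & g] &
    S p.1 != S (last z g) /\ S p.2 = S (last z g).
  move=> y'g /(IH z y' y'g) [p pg pP]; exists p => //.
  by rewrite /consec /= inE; apply/orP; right.
rewrite inE => /orP[/eqP -> xl|]; last exact: next.
have [zl|] := boolP (S z == S (last z g)); last by apply: next; rewrite inE eqxx.
by exists (x, z); [rewrite /consec /= inE eqxx | split=> //; exact/eqP].
Qed.

Lemma consec_constant x g : (forall p, p \in consec (x :: g) -> S p.1 = S p.2) ->
  forall y, y \in x :: g -> S y = S x.
Proof.
move=> Sg y; rewrite inE => /orP[/eqP ->//|yg].
apply/eqP/negPn/negP => /(consec_enter yg) [p /Sg ->] [->].
by rewrite eqxx.
Qed.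

End Consecutive.

(** * Thickness as the law of a random path *)

Section StGraph.
Context {R : realType} {G : stgraph R}.

Lemma edge_of_pair P p : @edges_are R G P -> p \in P ->
  exists e : edge G, (src e, tgt e) = p.
Proof.
move=> [_ /[apply]] c1.
have /card_gt0P[e] : (0 < #|[pred e : edge G | (src e, tgt e) == p]|)%N by rewrite c1.
by rewrite inE => /eqP ep; exists e.
Qed.

Lemma dwalk_crosses (S : vert G -> bool) x es : dwalk x es ->
  S x != S (dpath_end x es) -> has (crosses S) es.
Proof.
rewrite /dpath_end; elim: es x => [|e es IH] x /=; first by rewrite eqxx.
move=> /andP[/eqP <- we] Sl; rewrite /crosses.
have [E|//] := eqVneq (S (src e)) (S (tgt e)).
by apply: (IH (tgt e)) => //; rewrite -E.
Qed.

Hypothesis G_st : is_stgraph G.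

(** Thickness is the probability that a random path of the family uses the edge, so the sum is the
    mean length of that path; each path is a geodesic of length 1. *)
Lemma stgraph_mass : \sum_(e : edge G) th e * len e = 1.
Proof.
case: G_st => _ _ [_ d1] geo [F [F0 FP [_ thE]]].
have F0' : (size F)%:R != 0 :> R by rewrite pnatr_eq0 -lt0n.
under eq_bigr do rewrite thE mulrAC -mulrA -sum1_count natr_sum big_mkcond /= mulr_suml.
rewrite exchange_big /= big_seq (eq_bigr (fun=> (size F)%:R^-1)).
  by rewrite -big_seq sum_cst_seq mulfV.
move=> g gF; have [/andP[wg ug] eg] := FP g gF.
have ug' : uniq g by move: ug; rewrite /= => /andP[_ /map_uniq].
transitivity (\sum_(e <- g) len e / (size F)%:R).
  rewrite [RHS]big_uniq//= [RHS]big_mkcond /=; apply: eq_bigr => e _.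
  by case: ifP; rewrite ?mul1r ?mul0r.
by rewrite -mulr_suml (geo (sv G)) ?eg ?d1 ?mul1r// /dpath wg.
Qed.

(** The sum is the mean number of cut edges on a random path, and every path of the family has at
    least one. *)
Lemma stgraph_cut (S : vert G -> bool) : S (sv G) != S (tv G) ->
  1 <= \sum_(e : edge G) th e * (crosses S e)%:R.
Proof.
move=> Sst; case: G_st => _ _ [_ d1] geo [F [F0 FP [_ thE]]].
have F0' : (size F)%:R != 0 :> R by rewrite pnatr_eq0 -lt0n.
under eq_bigr do rewrite thE mulrAC -mulrA -sum1_count natr_sum big_mkcond /= mulr_suml.
rewrite exchange_big /=.
rewrite -[leLHS](mulfV F0') -sum_cst_seq big_seq [leRHS]big_seq.
apply: ler_sum => g gF; have [/andP[wg ug] eg] := FP g gF.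
have /hasP[e eg' Se] : has (crosses S) g.
  by apply: dwalk_crosses wg _; rewrite eg.
rewrite (bigD1 e)//= eg' Se !mul1r lerDl; apply: sumr_ge0 => e' _.
by rewrite !mulr_ge0 ?invr_ge0//; case: ifP.
Qed.

Lemma stgraph_len_ge0 (e : edge G) : 0 <= len e.
Proof. by case: G_st => _ /(_ e) /ltW. Qed.

Hypothesis G_conn : st_connected G.

Definition st_potential (v : vert G) : R := 1 - dist G v (tv G).

Lemma st_potential_lipschitz : edge_lipschitz st_potential.
Proof.
move=> e; have := dist_edge_lipschitz stgraph_len_ge0 G_conn (tv G) e.
rewrite /st_potential distrC.
by congr (`| _ | <= _); ring.
Qed.

Lemma st_potential_sv : st_potential (sv G) = 0.
Proof. by case: G_st => _ _ [_ d1] _ _; rewrite /st_potential d1 subrr. Qed.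

Lemma st_potential_tv : st_potential (tv G) = 1.
Proof. by rewrite /st_potential (dist_xx stgraph_len_ge0) subr0. Qed.

Lemma dist_st_sv : dist_st (sv G) = 0.
Proof.
by rewrite /dist_st (dist_xx stgraph_len_ge0) min_l// (dist_ge0 stgraph_len_ge0).
Qed.

Lemma dist_st_tv : dist_st (tv G) = 0.
Proof.
by rewrite /dist_st (dist_xx stgraph_len_ge0) min_r// (dist_ge0 stgraph_len_ge0).
Qed.

Lemma dist_st_ge0 (v : vert G) : 0 <= dist_st v.
Proof. by rewrite /dist_st le_min !(dist_ge0 stgraph_len_ge0). Qed.

Lemma dist_st_lipschitz : edge_lipschitz (@dist_st R G).
Proof.
move=> e; have := dist_edge_lipschitz stgraph_len_ge0 G_conn (sv G) e.
have := dist_edge_lipschitz stgraph_len_ge0 G_conn (tv G) e.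
rewrite /dist_st !ler_norml !minEle => /andP[a b] /andP[a' b'].
case: (leP (dist G (src e) (sv G)) (dist G (src e) (tv G))) => ?;
case: (leP (dist G (tgt e) (sv G)) (dist G (tgt e) (tv G))) => ?;
by apply/andP; split; lra.
Qed.

End StGraph.

(** The maximum starts from the value 0, which [x0] attains. *)
Lemma bigmax_attained (R : realType) (T : eqType) (g : seq T) (F : T -> R) x0 :
  x0 \in g -> F x0 = 0 -> (forall x, 0 <= F x) ->
  exists2 x, x \in g & \big[Num.max/0]_(x <- g) F x = F x.
Proof.
move=> x0g Fx0 F0.
have : \big[Num.max/0]_(x <- g) F x = 0 \/
    exists2 x, x \in g & \big[Num.max/0]_(x <- g) F x = F x.
  elim: g {x0g} => [|x g IH]; first by left; rewrite big_nil.
  right; rewrite big_cons; case: IH => [->|[y yg ->]].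
    by exists x; rewrite ?inE ?eqxx// max_l.
  rewrite maxElt; case: ifP => _; first by exists y; rewrite ?inE ?yg ?orbT.
  by exists x; rewrite ?inE ?eqxx.
by case=> // ->; exists x0.
Qed.

(** * Cuts and heights on a cycle *)

Section Cycle.
Context {R : realType} {Cy : stgraph R} {g1 g2 : seq (vert Cy)}.
Hypothesis Cy_cycle : is_stcycle Cy g1 g2.

Definition cut_size (S : vert Cy -> bool) : nat :=
  (\sum_(k : edge Cy) crosses S k)%N.

Lemma cut_size_gt1 (S : vert Cy -> bool) (k1 k2 : edge Cy) : k1 != k2 ->
  crosses S k1 -> crosses S k2 -> (1 < cut_size S)%N.
Proof.
move=> k12 S1 S2; rewrite /cut_size (bigD1 k1)//= (bigD1 k2) 1?eq_sym//=.
by rewrite S1 S2.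
Qed.

Lemma cycle_sides (g : seq (vert Cy)) : g = g1 \/ g = g2 ->
  [/\ exists g', g = sv Cy :: g' , last (sv Cy) g = tv Cy &
      forall p, p \in consec g -> exists k : edge Cy, (src k, tgt k) = p].
Proof.
case: Cy_cycle => _ _ [[h1 l1 s1 _] [h2 l2 s2 _]] _ E.
have edges (h : seq (vert Cy)) :
    {subset consec h <= consec g1 ++ consec g2} ->
    forall p, p \in consec h -> exists k : edge Cy, (src k, tgt k) = p.
  by move=> sub p /sub /(edge_of_pair E).
case=> ->; split=> //.
- by case: (g1) h1 s1 => //= x g' <- _; exists g'.
- by apply: edges => p pg; rewrite mem_cat pg.
- by case: (g2) h2 s2 => //= x g' <- _; exists g'.
- by apply: edges => p pg; rewrite mem_cat pg orbT.
Qed.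

Lemma cycle_connected : st_connected Cy.
Proof.
move=> S Se.
suff all_s x : S x = S (sv Cy) by move=> x y; rewrite !all_s.
have [_ _ _ [_ cov] _] := Cy_cycle.
have side g : g = g1 \/ g = g2 -> x \in g -> S x = S (sv Cy).
  move=> /cycle_sides[[g' ->] _ ed]; apply: consec_constant => p /ed [k <-].
  exact: Se.
by case: (cov x); apply: side; [left | right].
Qed.

(** The cut inequality with all thicknesses equal to 1/2 forces two cut edges. *)
Lemma cycle_cut_st (S : vert Cy -> bool) : S (sv Cy) != S (tv Cy) ->
  (1 < cut_size S)%N.
Proof.
have [G_st th2 _ _ _] := Cy_cycle.
move=> /(stgraph_cut G_st); under eq_bigr do rewrite th2.
rewrite -mulr_sumr -natr_sum -/(cut_size S) mulrC ler_pdivlMr// mul1r.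
by rewrite ler_nat.
Qed.

(* A side whose ends lie together leaves their part of the cut and comes back;
   the two edges differ because their sources lie in different parts. *)
Lemma cycle_cut_side (S : vert Cy -> bool) g x : g = g1 \/ g = g2 ->
  S (sv Cy) = S (tv Cy) -> x \in g -> S x != S (sv Cy) -> (1 < cut_size S)%N.
Proof.
move=> /cycle_sides[[g' ->] /= lg ed] st xg xs.
have xg' : x \in g'.
  by move: xg; rewrite inE => /orP[/eqP xE|//]; rewrite xE eqxx in xs.
have [p /ed [k1 k1p] [p1 p2]] := consec_enter xg' xs.
have [|q /ed [k2 k2q] [q1 q2]] := consec_leave (S := S) xg; first by rewrite lg -st.
rewrite lg -st in q1 q2.
apply: (@cut_size_gt1 S k1 k2).
- by apply: contra_neq q1 => k12; rewrite -p1 -k1p -k2q k12.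
- by rewrite /crosses; move: p1 p2; rewrite -k1p /= => -> ; rewrite eq_sym.
- by rewrite /crosses; move: q1 q2; rewrite -k2q /= => + ->.
Qed.

(** If the terminals lie together, one of [u] and [w] lies apart from them, and its side is cut
    twice. *)
Lemma cycle_cut_uw (S : vert Cy -> bool) u w : u \in g1 -> w \in g2 ->
  S u != S w -> (1 < cut_size S)%N.
Proof.
move=> u1 w2 uw; have [st|/cycle_cut_st//] := eqVneq (S (sv Cy)) (S (tv Cy)).
have [us|us] := eqVneq (S u) (S (sv Cy)).
  by apply: (@cycle_cut_side S g2 w) => //; [right | rewrite -us eq_sym].
by apply: (@cycle_cut_side S g1 u) => //; left.
Qed.

(** The sign tells the sides apart, and the height vanishes where they meet; between the two tops it
    changes by [ht_cyc]. *)
Definition side_height (v : vert Cy) : R :=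
  if v \in g1 then dist_st v else - dist_st v.

Lemma side_height_g2 v : v \in g2 -> side_height v = - dist_st v.
Proof.
have [G_st _ _ [disj _] _] := Cy_cycle.
rewrite /side_height => v2; case: ifP => // v1.
by have [->|->] := disj v v1 v2; rewrite ?dist_st_sv ?dist_st_tv ?oppr0.
Qed.

(** Every edge has both ends on one side, where the height is [dist_st] up to a fixed sign. *)
Lemma side_height_lipschitz : edge_lipschitz side_height.
Proof.
have [G_st _ _ _ [ed _]] := Cy_cycle.
move=> k; have := ed k; have := dist_st_lipschitz G_st cycle_connected k.
rewrite mem_cat => lip /orP[/mem_consec|/mem_consec] /= [sk tk].
  by rewrite /side_height sk tk.
by rewrite !side_height_g2// -opprD normrN.
Qed.

Lemma side_height_sv : side_height (sv Cy) = 0.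
Proof.
by have [G_st _ _ _ _] := Cy_cycle; rewrite /side_height dist_st_sv// oppr0 if_same.
Qed.

Lemma side_height_tv : side_height (tv Cy) = 0.
Proof.
by have [G_st _ _ _ _] := Cy_cycle; rewrite /side_height dist_st_tv// oppr0 if_same.
Qed.

Lemma ht_cyc_attained : exists u w, [/\ u \in g1, w \in g2 &
  ht_cyc Cy g1 g2 = side_height u - side_height w].
Proof.
have [G_st _ _ _ _] := Cy_cycle.
have mem_s g : g = g1 \/ g = g2 -> sv Cy \in g.
  by move=> /cycle_sides[[g' ->] _ _]; rewrite inE eqxx.
have max_g g : g = g1 \/ g = g2 -> exists2 x, x \in g &
    \big[Num.max/0]_(v <- g) dist_st v = dist_st x.
  move=> /mem_s sg; apply: bigmax_attained sg _ _; first exact: dist_st_sv.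
  exact: dist_st_ge0.
have [u u1 uE] := max_g g1 (or_introl erefl).
have [w w2 wE] := max_g g2 (or_intror erefl).
exists u, w; split=> //.
by rewrite /ht_cyc uE wE (side_height_g2 w2) opprK /side_height u1.
Qed.

End Cycle.

Lemma stpath_connected (R : realType) (Pa : stgraph R) :
  is_stpath Pa -> st_connected Pa.
Proof.
move=> [_ _ [g [_ _ cov ed]]] S Se.
suff all_s x : S x = S (sv Pa) by move=> x y; rewrite !all_s.
apply: consec_constant (cov x) => p /(edge_of_pair ed) [e <-]; exact: Se.
Qed.

(** * Gluing a graph in place of an edge *)

Section EdgeReplacement.
Context {R : realType} {G K : stgraph R} (e : edge G).
Hypothesis st_neq : sv K != tv K.

Lemma emb_rep_sv : emb_rep e (sv K) = inl (src e).
Proof. by rewrite /emb_rep insubN ?eqxx. Qed.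

Lemma emb_rep_tv : emb_rep e (tv K) = inl (tgt e).
Proof. by rewrite /emb_rep insubN ?eqxx ?andbF// eq_sym (negbTE st_neq). Qed.

Lemma emb_rep_inner (x : inner K) : emb_rep e (val x) = inr x.
Proof. by rewrite /emb_rep valK. Qed.

Definition replace_extend (g : vert G -> R) (b : vert K -> R)
    (x : vert (edge_replace G e K)) : R :=
  match x with inl v => g v | inr y => b (val y) end.

Lemma replace_extend_emb g b : b (sv K) = g (src e) -> b (tv K) = g (tgt e) ->
  forall x, replace_extend g b (emb_rep e x) = b x.
Proof.
move=> bs bt x; have [x0|] := boolP ((x != sv K) && (x != tv K)).
  have -> : x = val (Sub x x0 : inner K) by [].
  by rewrite emb_rep_inner.
rewrite negb_and !negbK => /orP[] /eqP ->.
  by rewrite emb_rep_sv bs.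
by rewrite emb_rep_tv bt.
Qed.

Definition in_replacement (h : edge (edge_replace G e K)) : bool :=
  if h is inr _ then true else false.

Lemma replace_connected : st_connected G -> st_connected K ->
  st_connected (edge_replace G e K).
Proof.
move=> cG cK S Se.
have block x y : S (emb_rep e x) = S (emb_rep e y).
  by apply: (cK (fun x => S (emb_rep e x))) => k; exact: (Se (inr k)).
have base x y : S (inl x) = S (inl y).
  apply: (cG (fun x => S (inl x))) => e'.
  have [->|e'e] := eqVneq e' e.
    by rewrite -emb_rep_sv -emb_rep_tv; exact: block.
  exact: (Se (inl (exist _ e' e'e))).
have red x : exists y, S x = S (inl y).
  case: x => [y|y]; first by exists y.
  by exists (src e); rewrite -emb_rep_sv -emb_rep_inner; exact: block.
by move=> x y; have [x' ->] := red x; have [y' ->] := red y.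
Qed.

Lemma replace_mass : \sum_(e' : edge G) th e' * len e' = 1 ->
  \sum_(k : edge K) th k * len k = 1 ->
  \sum_(h : edge (edge_replace G e K)) th h * len h = 1.
Proof.
move=> mG mK; rewrite big_sumType /= (sum_sig _ (fun e' => th e' * len e')).
under [X in _ + X]eq_bigr do rewrite mulrACA.
by rewrite -mulr_sumr mK mulr1 -mG [RHS](bigD1 e)//= addrC.
Qed.

Lemma ncross_replacement (S : vert (edge_replace G e K) -> bool) :
  ncross_block in_replacement true S = cut_size (fun x => S (emb_rep e x)).
Proof. by rewrite /ncross_block big_sumType /= big1_eq add0n. Qed.

Lemma ncross_outside (S : vert (edge_replace G e K) -> bool) (e' : edge G) :
  e' != e -> crosses (fun x => S (inl x)) e' ->
  (0 < ncross_block in_replacement false S)%N.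
Proof.
move=> e'e Se'; rewrite /ncross_block (bigD1 (inl (exist _ e' e'e)))//=.
by rewrite [X in nat_of_bool X](_ : _ = true).
Qed.

End EdgeReplacement.

(** It remains to supply the marked cycle, the tops of its sides, and the functions [phi] and [psi]
    for the cycle-with-handles. *)
Theorem theorem4p20 (R : realType) (Pa Cy : stgraph R) (e_rep : edge Pa)
    (g1 g2 : seq (vert Cy)) :
  is_stpath Pa -> is_stcycle Cy g1 g2 ->
  forall n : nat,
    (((2 - Num.sqrt 2) / 4 * len e_rep * ht_cyc Cy g1 g2 * n%:R)%:E
       <= c1 (@tc_dist R (spow (edge_replace Pa e_rep Cy) n)))%E.
Proof.
move=> Pa_path Cy_cycle n.
have [Pa_st Pa_th _] := Pa_path.
have [Cy_st Cy_th _ _ _] := Cy_cycle.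
have Pa_conn := stpath_connected Pa_path.
have Cy_conn := cycle_connected Cy_cycle.
have st_neq : sv Cy != tv Cy by case: Cy_st.
have [u [w [u1 w2 htE]]] := ht_cyc_attained Cy_cycle.
have ht0 : 0 <= ht_cyc Cy g1 g2.
  rewrite htE (side_height_g2 Cy_cycle w2) opprK /side_height u1.
  by rewrite addr_ge0 ?dist_st_ge0.
have len0 : 0 <= len e_rep by exact: stgraph_len_ge0.
(* The factor [len e_rep] matches the rescaled lengths of the copied edges. *)
pose phi := replace_extend (K := Cy) (e := e_rep) (fun=> 0)
  (fun x => len e_rep * side_height (g1 := g1) x).
pose psi := replace_extend (K := Cy) (e := e_rep) st_potential
  (fun x => st_potential (src e_rep) +
     (st_potential (tgt e_rep) - st_potential (src e_rep)) * st_potential x).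
have phiE x : phi (emb_rep e_rep x) = len e_rep * side_height (g1 := g1) x.
  rewrite /phi replace_extend_emb//.
  - by rewrite (side_height_sv Cy_cycle) mulr0.
  - by rewrite (side_height_tv Cy_cycle) mulr0.
have psiE x : psi (emb_rep e_rep x) = st_potential (src e_rep) +
     (st_potential (tgt e_rep) - st_potential (src e_rep)) * st_potential x.
  rewrite /psi replace_extend_emb//.
  - by rewrite (st_potential_sv Cy_st) mulr0 addr0.
  - by rewrite (st_potential_tv Cy_st) mulr1 addrC subrK.
apply: le_ereal_inf_tmp => _ [D D_emb <-]; rewrite lee_fin.
(* The bound proved below is twice the one claimed. *)
apply: (@le_trans _ _ ((1 - Num.sqrt 2 / 2) * (len e_rep * ht_cyc Cy g1 g2 * n%:R))).
  rewrite -subr_ge0 (_ : _ - _ = (1 - Num.sqrt 2 / 2) / 2 *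
    (len e_rep * ht_cyc Cy g1 g2 * n%:R)); last by field.
  by rewrite !mulr_ge0 ?signed_const_ge0.
apply: (@L1_embeds_spow R _ (@in_replacement R Pa Cy e_rep)
  (emb_rep e_rep u) (emb_rep e_rep w) (len e_rep * ht_cyc Cy g1 g2) psi phi) D_emb.
- by have [+ _ _ _ _] := Pa_st; apply: contra_neq => -[].
- move=> [e'|k] /=; first exact: stgraph_len_ge0.
  by rewrite mulr_ge0// stgraph_len_ge0.
- by move=> [e'|k] /=; rewrite ?Pa_th ?Cy_th ?mul1r ?expr0 ?expr1.
- by apply: replace_mass; exact: stgraph_mass.
(* A cut between the terminals cuts some edge of the path: either one that survives in the handle,
   or [e_rep], whose cycle is then cut twice. *)
- move=> S Sst; rewrite ncross_replacement.
  have [e' Se'] : exists e', crosses (fun x => S (inl x)) e'.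
    apply/existsP; apply: contraTT (stgraph_cut (S := fun x => S (inl x)) Pa_st Sst).
    rewrite negb_exists => /forallP noS; rewrite -ltNge big1 ?ltr01// => e' _.
    by rewrite (negbTE (noS e')) mulr0.
  have [e'E|/ncross_outside -> //] := eqVneq e' e_rep.
  apply/orP; right; apply: (cycle_cut_st Cy_cycle).
  by move: Se'; rewrite e'E /crosses -(emb_rep_sv (K := Cy)) -(emb_rep_tv _ st_neq).
- move=> S Suw; rewrite ncross_replacement.
  exact: (cycle_cut_uw (S := fun x => S (emb_rep e_rep x)) Cy_cycle u1 w2).
- exact: replace_connected.
- move=> [e'|k] /=; first exact: st_potential_lipschitz.
  rewrite !psiE (_ : _ - _ = (st_potential (tgt e_rep) - st_potential (src e_rep)) *
    (st_potential (src k) - st_potential (tgt k))); last by ring.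
  by rewrite normrM ler_pM//; [rewrite distrC|]; exact: st_potential_lipschitz.
- exact: st_potential_sv.
- exact: st_potential_tv.
- move=> [e'|k] /=; first by rewrite subrr normr0 stgraph_len_ge0.
  rewrite !phiE -mulrBr normrM ger0_norm// ler_wpM2l//.
  exact: (side_height_lipschitz Cy_cycle).
- by [].
- by [].
- by case.
- by rewrite !phiE -mulrBr -htE.
Qed.
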